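(* Let $\mathcal X\subset\mathbb R^d$ be compact, and suppose that $\bm f:\mathcal X\to\mathbb R^m$ has a multi-output Gaussian process prior with continuously differentiable mean and covariance functions. Let $\mathcal D^n$ be a fixed set of $n$ (noisy) observations, let $X^n=\{\bm x^t\}_{t=1}^n$ be the set of observed decision vectors in $\mathcal D^n$, and let $\alpha_{\mathrm{NESPI}}$ be the noisy expected single-point improvement and $\hat\alpha^N_{\mathrm{NESPI}}$ its sample average approximation built from i.i.d. base samples $\epsilon^1,\dots,\epsilon^N\sim\mathcal N(0,I_{(n+1)m})$, both as defined in the context. Let $$\alpha_{\mathrm{NESPI}}^*:=\max_{\bm x\in\mathcal X}\alpha_{\mathrm{NESPI}}(\bm x),\qquad S^*:=\operatorname*{arg\,max}_{\bm x\in\mathcal X}\alpha_{\mathrm{NESPI}}(\bm x),$$ and, for each $N$, suppose $\hat{\bm x}_N^*\in\operatorname*{arg\,max}_{\bm x\in\mathcal X}\hat\alpha^N_{\mathrm{NESPI}}(\bm x)$. Then, as $N\to\infty$: (1) $\hat\alpha^N_{\mathrm{NESPI}}(\hat{\bm x}_N^* )\to\alpha_{\mathrm{NESPI}}^*$ almost surely; (2) $d(\hat{\bm x}_N^*,S^* )\to0$ almost surely, where $d(\hat{\bm x}_N^*,S^* ):=\inf_{\bm x\in S^*}\|\hat{\bm x}_N^*-\bm x\|$.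
   Context: Throughout, $\|\cdot\|$ is the Euclidean norm, $m$ is the number of objectives (to be minimised), and ''almost surely'' refers to the randomness of the infinite i.i.d. sequence $(\epsilon^t)_{t\ge1}$ of base samples; the data are fixed. Data. $\mathcal D^n=\{(\bm x^t,\bm y^t)\}_{t=1}^n$ with $n\ge1$, $\bm x^t\in\mathcal X$ and $\bm y^t=\bm f(\bm x^t)+\bm\zeta^t\in\mathbb R^m$, where the noise terms $\bm\zeta^t\sim\mathcal N(0,\mathrm{diag}(\bm\sigma_\zeta^2))$ are independent. The point $\bm z^*\in\mathbb R^m$ is a fixed utopian point, i.e. $z_i^*\le\min_{\bm x\in\mathcal X}f_i(\bm x)$ for the true objectives $f_i$. Joint posterior. For $\bm x\in\mathcal X$, the posterior given $\mathcal D^n$ of the stacked vector $(\bm f(\bm x^1),\dots,\bm f(\bm x^n),\bm f(\bm x))\in\mathbb R^{(n+1)m}$ is Gaussian with mean $\mu(X^n,\bm x)\in\mathbb R^{(n+1)m}$ and covariance $K(X^n,\bm x)\in\mathbb R^{(n+1)m\times(n+1)m}$, given by the usual Gaussian process conditioning: if the prior has mean function $\bm m$ and matrix-valued covariance function $k$, then for any $\bm a,\bm b\in\mathcal X$ the posterior mean of $\bm f(\bm a)$ is $\bm m(\bm a)+k(\bm a,X^n)\,G^{-1}(Y-\bm m(X^n))$ and the posterior covariance of $\bm f(\bm a)$ and $\bm f(\bm b)$ is $k(\bm a,\bm b)-k(\bm a,X^n)\,G^{-1}k(X^n,\bm b)$, where $Y\in\mathbb R^{nm}$ stacks the $\bm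 y^t$ and $G=k(X^n,X^n)+I_n\otimes\mathrm{diag}(\bm\sigma_\zeta^2)\in\mathbb R^{nm\times nm}$ (with the inverse read as the Moore–Penrose pseudoinverse if $G$ is singular). Acquisition function (NESPI). The noisy expected single-point improvement integrates the single-point improvement over the posterior, including over the uncertain function values at $X^n$ that determine the best distance so far: $$\alpha_{\mathrm{NESPI}}(\bm x)=\mathbb E\Big[\max\Big(0,\;\min_{1\le i\le n}\|\bm f(\bm x^i)-\bm z^*\|-\|\bm f(\bm x)-\bm z^*\|\Big)\Big],$$ the expectation being over the joint posterior $(\bm f(\bm x^1),\dots,\bm f(\bm x^n),\bm f(\bm x))\sim\mathcal N(\mu(X^n,\bm x),K(X^n,\bm x))$. Sample average approximation. Let $L(X^n,\bm x)\in\mathbb R^{(n+1)m\times(n+1)m}$ be a root decomposition of the joint posterior covariance, i.e. $L(X^n,\bm x)L(X^n,\bm x)^{\top}=K(X^n,\bm x)$ (e.g. a Cholesky factor). For $i=1,\dots,n+1$ let $S_i\in\mathbb R^{m\times(n+1)m}$ be the selector matrix extracting the $i$-th block of $m$ coordinates (blocks $1,\dots,n$ correspond to $\bm x^1,\dots,\bm x^n$, block $n+1$ to the candidate $\bm x$), and set $$\bm f_i(\bm x,\epsilon)=S_i\big(\mu(X^n,\bm x)+L(X^n,\bm x)\epsilon\big)\in\mathbb R^m,\qquad \epsilon\in\mathbb R^{(n+1)m}.$$ With base samples $\epsilon^t$ drawn once and held fixed over all $\bm x$, the deterministic approximation is $$\hat\alpha_{\mathrm{NESPI}}^N(\bm x)=\frac1N\sum_{t=1}^N\max\Big(0,\;\min_{1\le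 i\le n}\|\bm f_i(\bm x,\epsilon^t)-\bm z^*\|-\|\bm f_{n+1}(\bm x,\epsilon^t)-\bm z^*\|\Big).$$ *)

(* Defs.v *)
From HB Require Import structures.
From mathcomp Require Import all_boot all_order all_algebra.
From mathcomp Require Import all_classical all_reals all_analysis.

Set Implicit Arguments.
Unset Strict Implicit.
Unset Printing Implicit Defensive.

Import Order.TTheory GRing.Theory Num.Theory.
Import numFieldNormedType.Exports.

Local Open Scope classical_set_scope.
Local Open Scope ring_scope.

(* Points of R^d are row vectors; objective vectors in R^m are column vectors.
   A vector of n stacked blocks of R^m is a \mxcol of columns, so its dimension
   n * m appears as \sum_(i < n) m. *)
Notation stackdim n m := (\sum_(i < n) m)%N (only parsing).

Section Analysis.
Context {R : realType}.

(* The library norm on matrices is the sup norm; this is the Euclidean one. *)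
Definition enorm p q (A : 'M[R]_(p, q)) : R :=
  Num.sqrt (\sum_i \sum_j A i j ^+ 2).

Definition edist_to d (x : 'rV[R]_d) (S : set 'rV[R]_d) : R :=
  inf [set enorm (x - y) | y in S].

Definition argmax (T : Type) (X : set T) (g : T -> R) : set T :=
  [set x | X x /\ forall y, X y -> g y <= g x].

(* The maximum of g over X as soon as argmax X g is not empty. *)
Definition maxval (T : Type) (X : set T) (g : T -> R) : R := sup (g @` X).

Definition min_ord n (n_gt0 : (0 < n)%N) (g : 'I_n -> R) : R :=
  \big[Num.min/g (Ordinal n_gt0)]_(i < n) g i.

(* Continuous differentiability on a set A that need not be open: f coincides
   on A with a function that is C^1 on an open neighbourhood of A.  In finite
   dimension, continuity of all the directional derivatives is continuity of the
   differential. *)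
Definition C1_on (V W : normedModType R) (A : set V) (f : V -> W) : Prop :=
  exists (U : set V) (g : V -> W),
    [/\ open U, A `<=` U, (forall x, A x -> f x = g x),
        (forall x, U x -> differentiable g x) &
        (forall v x, U x -> {for x, continuous (fun y => 'D_v g y)})].

Definition penrose p q (G : 'M[R]_(p, q)) (H : 'M[R]_(q, p)) : Prop :=
  [/\ G *m H *m G = G, H *m G *m H = H,
      (G *m H)^T = G *m H & (H *m G)^T = H *m G].

(* Moore-Penrose pseudoinverse (mxalgebra's pinvmx only satisfies the first of
   the four Penrose equations). *)
Definition mpinv p q (G : 'M[R]_(p, q)) : 'M[R]_(q, p) :=
  xget 0 [set H | penrose G H].

Lemma gram_unit p q (C : 'M[R]_(p, q)) : row_free C^T -> C^T *m C \in unitmx.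
Proof.
move=> fC; rewrite -row_free_unit; apply: inj_row_free => v vCC.
have vC0 : v *m C^T = 0.
  have : (v *m C^T) *m (v *m C^T)^T = 0.
    by rewrite trmx_mul trmxK !mulmxA -(mulmxA v) vCC mul0mx.
  move/matrixP/(_ 0 0); rewrite !mxE => s0.
  apply/rowP => j; rewrite [RHS]mxE; apply/eqP; rewrite -sqrf_eq0.
  have := psumr_eq0P _ s0.
  move/(_ (fun k _ => ltac:(rewrite [X in _ * X]mxE -expr2; exact: sqr_ge0))).
  by move/(_ j isT); rewrite [X in _ * X]mxE -expr2 => ->.
by apply: (row_free_inj fC); rewrite vC0 mul0mx.
Qed.

Lemma penrose_ex p q (G : 'M[R]_(p, q)) : exists H, penrose G H.
Proof.
have [r [C [B [GE fC fB]]]] : exists r (C : 'M[R]_(p, r)) (B : 'M[R]_(r, q)),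
    [/\ G = C *m B, row_free C^T & row_free B].
  exists (\rank G), (col_base G), (row_base G); split.
  - by rewrite mulmx_base.
  - by rewrite /row_free mxrank_tr; exact: col_base_full.
  - exact: row_base_free.
have uC : C^T *m C \in unitmx by exact: gram_unit.
have uB : B *m B^T \in unitmx.
  by have := @gram_unit _ _ B^T; rewrite trmxK; exact.
set c := invmx (C^T *m C); set b := invmx (B *m B^T).
have ct : c^T = c by rewrite trmx_inv trmx_mul trmxK.
have bt : b^T = b by rewrite trmx_inv trmx_mul trmxK.
pose H := B^T *m b *m c *m C^T.
have GH : G *m H = C *m c *m C^T.
  rewrite GE /H !mulmxA -(mulmxA C B) -(mulmxA C (B *m B^T)).
  by rewrite mulmxV // mulmx1.
have HG : H *m G = B^T *m b *m B.
  rewrite GE /H !mulmxA -(mulmxA _ C^T C) -(mulmxA _ c).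
  by rewrite mulVmx // mulmx1.
exists H; split.
- rewrite GH GE !mulmxA -(mulmxA _ C^T C) -(mulmxA C c).
  by rewrite mulVmx // mulmx1.
- rewrite HG /H !mulmxA -(mulmxA _ B B^T) -(mulmxA _ b (B *m _)).
  by rewrite mulVmx // mulmx1.
- by rewrite GH !trmx_mul trmxK ct mulmxA.
- by rewrite HG !trmx_mul trmxK bt mulmxA.
Qed.

Lemma mpinvP p q (G : 'M[R]_(p, q)) : penrose G (mpinv G).
Proof. by case: (penrose_ex G) => H HG; exact: (@xgetI _ _ _ H HG). Qed.

Lemma mpinv_unit p (G : 'M[R]_p) : G \in unitmx -> mpinv G = invmx G.
Proof.
move=> uG; have [GHG _ _ _] := mpinvP G.
have := congr1 (fun M => invmx G *m M *m invmx G) GHG.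
by rewrite !mulmxA mulVmx // mul1mx mulmxK // mul1mx.
Qed.

End Analysis.

Section GaussianVectors.
Context {R : realType} {dO : measure_display} {Om : measurableType dO}.
Variable P : probability Om R.

(* N(c, v) on the real line, with v the variance; N(c, 0) is the Dirac mass. *)
Definition normal_law (c v : R) (B : set R) : \bar R :=
  if v == 0 then \d_c B else normal_prob c (Num.sqrt v) B.

(* Z ~ N(mu, K), K possibly singular: every linear combination a^T Z is
   N(a^T mu, a^T K a).  Symmetry of K is required because the quadratic forms
   only determine its symmetric part. *)
Definition gaussian_vector k (Z : Om -> 'cV[R]_k) (mu : 'cV[R]_k)
    (K : 'M[R]_k) : Prop :=
  [/\ K^T = K,
      (forall a : 'cV[R]_k, 0 <= (a^T *m K *m a) 0 0),
      (forall i, measurable_fun setT (fun w => Z w i 0)) &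
      (forall (a : 'cV[R]_k) (B : set R), measurable B ->
         P [set w | B ((a^T *m Z w) 0 0)] =
         normal_law ((a^T *m mu) 0 0) ((a^T *m K *m a) 0 0) B)].

Definition borel (T : topologicalType) : set (set T) := <<s [set U | open U] >>.

Definition independent_vectors (I : eqType) k (Z : I -> Om -> 'cV[R]_k) :
    Prop :=
  forall (J : seq I) (B : I -> set 'cV[R]_k), uniq J ->
    (forall i, borel (B i)) ->
    P (\bigcap_(i in [set` J]) (Z i @^-1` B i)) =
    (\prod_(i <- J) P (Z i @^-1` B i))%E.

Definition gaussian_process d m (X : set 'rV[R]_d)
    (f : 'rV[R]_d -> Om -> 'cV[R]_m) (mean : 'rV[R]_d -> 'cV[R]_m)
    (k : 'rV[R]_d -> 'rV[R]_d -> 'M[R]_m) : Prop :=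
  forall (N : nat) (p : 'I_N -> 'rV[R]_d), (forall i, X (p i)) ->
    gaussian_vector (fun w => \mxcol_(i < N) f (p i) w)
      (\mxcol_(i < N) mean (p i)) (\mxblock_(i < N, j < N) k (p i) (p j)).

End GaussianVectors.

Section Posterior.
Context {R : realType} {d m n : nat}.
Variables (mean : 'rV[R]_d -> 'cV[R]_m) (k : 'rV[R]_d -> 'rV[R]_d -> 'M[R]_m).
Variables (sigma : 'rV[R]_m) (xs : 'I_n -> 'rV[R]_d) (ys : 'I_n -> 'cV[R]_m).

Definition noise_cov : 'M[R]_m := diag_mx (\row_j sigma 0 j ^+ 2).

Definition data_gram : 'M[R]_(stackdim n m) :=
  \mxblock_(s < n, t < n) k (xs s) (xs t) + \mxdiag_(t < n) noise_cov.

Definition post_mean (a : 'rV[R]_d) : 'cV[R]_m :=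
  mean a + (\mxrow_(t < n) k a (xs t)) *m mpinv data_gram
           *m (\mxcol_(t < n) ys t - \mxcol_(t < n) mean (xs t)).

Definition post_cov (a b : 'rV[R]_d) : 'M[R]_m :=
  k a b - (\mxrow_(t < n) k a (xs t)) *m mpinv data_gram
          *m (\mxcol_(t < n) k (xs t) b).

(* x^1, ..., x^n followed by the candidate x; the embedding of the first n
   positions into 'I_n.+1 is [lift ord_max]. *)
Definition joint_pt (x : 'rV[R]_d) (i : 'I_n.+1) : 'rV[R]_d :=
  oapp xs x (unlift ord_max i).

Definition joint_mean (x : 'rV[R]_d) : 'cV[R]_(stackdim n.+1 m) :=
  \mxcol_(i < n.+1) post_mean (joint_pt x i).

Definition joint_cov (x : 'rV[R]_d) : 'M[R]_(stackdim n.+1 m) :=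
  \mxblock_(i < n.+1, j < n.+1) post_cov (joint_pt x i) (joint_pt x j).

End Posterior.

Section Acquisition.
Context {R : realType} {d m n : nat}.
Variables (n_gt0 : (0 < n)%N) (z : 'cV[R]_m).

Definition selector (i : 'I_n.+1) : 'M[R]_(m, stackdim n.+1 m) :=
  @submxcol R n.+1 (fun=> m) _ 1%:M i.

Definition improvement (v : 'cV[R]_(stackdim n.+1 m)) : R :=
  Num.max 0 (min_ord n_gt0 (fun i => enorm (selector (lift ord_max i) *m v - z))
             - enorm (selector ord_max *m v - z)).

(* F x is a random vector distributed as the joint posterior of
   (f(x^1), ..., f(x^n), f(x)). *)
Definition nespi {dO : measure_display} {Om : measurableType dO}
    (P : probability Om R) (F : 'rV[R]_d -> Om -> 'cV[R]_(stackdim n.+1 m))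
    (x : 'rV[R]_d) : R :=
  fine ('E_P[fun w => improvement (F x w)])%E.

Definition nespi_saa (mu : 'rV[R]_d -> 'cV[R]_(stackdim n.+1 m))
    (L : 'rV[R]_d -> 'M[R]_(stackdim n.+1 m))
    (eps : nat -> 'cV[R]_(stackdim n.+1 m)) (N : nat) (x : 'rV[R]_d) : R :=
  N%:R^-1 * \sum_(t < N) improvement (mu x + L x *m eps t).

End Acquisition.

(* Main.v *)
Require Import Defs.
From HB Require Import structures.
From mathcomp Require Import all_boot all_order all_algebra.
From mathcomp Require Import all_classical all_reals all_analysis.
From mathcomp Require Import measurable_realfun.
From mathcomp Require Import ring lra.

Set Implicit Arguments.
Unset Strict Implicit.
Unset Printing Implicit Defensive.

Import Order.TTheory GRing.Theory Num.Theory.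
Import numFieldNormedType.Exports.

Local Open Scope classical_set_scope.
Local Open Scope ring_scope.

(** The root L(x) of the posterior covariance may depend on x in an arbitrary,
    even non-measurable, way; only L(x) L(x)^T is continuous.  The law of large
    numbers is therefore proved uniformly over all pairs (mu, L) in a bounded
    set: the improvement is Lipschitz in (mu, L) with an integrable constant, so
    a finite grid of pairs suffices.

    The expectation over mu + L eps depends only on (mu, L L^T), because a
    random vector is determined by the laws of its linear projections.  This is
    shown without characteristic functions: the improvement is built from
    coordinates by ring operations and square roots, replacing every coordinate
    z by M sin(z / M) turns it into a uniform limit of trigonometric
    polynomials, and M tends to infinity by dominated convergence.

    Finally the acquisition function attains its maximum on every compact
    subset, since it is a continuous function on the compact set of pairs (x, M)
    with M M^T = K(x).  Applied to the points of X at distance at least e from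
    the maximisers, this gives the gap which forces convergence of the
    approximate maximisers. *)

(** * The normal law *)

Section NormalLaw.
Context {R : realType}.
Local Notation leb := (@lebesgue_measure R).

(** Nothing is known about how [xhat] depends on the outcome, so the almost sure event must be fixed
    before any maximiser is looked at. The uniform law supplies it: outside one negligible set it
    speaks of all bounded pairs (mu, L) at once, and from there on the argument is deterministic.
    Random vectors are known only through the laws of their projections, and the posterior lives on
    a probability space unrelated to that of the base samples. Even the equality of E g(eps t) for
    different t therefore goes through the uniqueness result. The functions averaged are nonnegative
    and of linear growth, hence have finite second moments under a Gaussian law. For them pairwise
    independence yields the strong law: summable variances give convergence along the squares, and
    monotone partial sums fill the gaps. Boundedness of the roots comes from the diagonal of L L^T,
    which holds the squared norms of the rows of L. *)

Lemma measurable_shift (c : R) :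
  measurable_fun setT (fun x : measurableTypeR R => (x + c : measurableTypeR R)).
Proof. by apply: measurable_funD => //; exact: measurable_cst. Qed.

(** The pushforward under the shift agrees with Lebesgue measure on half-open intervals, and these
    determine it. *)
Lemma lebesgue_measure_shift (c : R) (A : set R) : measurable A ->
  leb ((fun x => x + c) @^-1` A) = leb A.
Proof.
move=> mA.
pose sh : measurableTypeR R -> measurableTypeR R := fun x => x + c.
pose shm : {mfun measurableTypeR R >-> measurableTypeR R} :=
  HB.pack sh (isMeasurableFun.Build _ _ _ _ sh (measurable_shift c)).
suff -> : leb A = pushforward leb shm A by [].
apply: lebesgue_measure_unique => // _ [[a b]] _ <-.
rewrite /pushforward/=.
rewrite [X in _ = leb X](_ : _ = `]a - c, b - c]%classic); last first.
  by apply/seteqP; split=> x /=; rewrite /sh !in_itv/= ltrBlDr lerBrDr.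
rewrite !lebesgue_measure_itv/= !lte_fin ltrD2r; case: ifP => // _.
by rewrite -!EFinD; congr EFin; ring.
Qed.

Lemma normal_prob_shift (c s : R) (B : set R) : s != 0 -> measurable B ->
  normal_prob c s B = normal_prob 0 s ((fun x => x + c) @^-1` B).
Proof.
move=> s0 mB; rewrite /normal_prob.
transitivity (\int[pushforward leb (fun x : measurableTypeR R =>
    (x + c)%R : measurableTypeR R)]_(x in B) (normal_pdf c s x)%:E)%E.
  apply: eq_measure_integral => [|? A mA _]; first exact: measurable_shift.
  exact/esym/lebesgue_measure_shift.
rewrite ge0_integral_pushforward//.
- apply: eq_integral => x _ /=; rewrite !normal_pdfE// /normal_fun.
  by rewrite addrK subr0.
- exact: measurable_shift.
- by apply: measurable_funTS; apply/measurable_EFinP; exact: measurable_normal_pdf.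
- by move=> x _; rewrite lee_fin normal_pdf_ge0.
Qed.

Lemma normal_law_shift (c v : R) (B : set R) : measurable B -> 0 <= v ->
  normal_law c v B = normal_law 0 v ((fun x => x + c) @^-1` B).
Proof.
move=> mB v0; rewrite /normal_law; case: eqVneq => [_|vn0].
  by rewrite !diracE; congr ((nat_of_bool _)%:R%:E); apply/idP/idP;
    rewrite !inE /= add0r.
by rewrite normal_prob_shift// gt_eqF// sqrtr_gt0 lt_def vn0.
Qed.

(** The Radon-Nikodym derivative of the normal law agrees almost everywhere with the explicit
    density, because both integrate to that law over every measurable set. *)
Lemma ge0_integral_normal_prob (c s : R) (h : R -> \bar R) :
  measurable_fun setT h -> (forall x, (0 <= h x)%E) ->
  (\int[normal_prob c s]_x h x = \int[leb]_x (h x * (normal_pdf c s x)%:E))%E.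
Proof.
move=> mh h0.
have dom := normal_prob_dominates c s.
rewrite -(Radon_Nikodym_SigmaFinite.change_of_variables dom)//.
apply: ae_eq_integral => //.
- apply: emeasurable_funM => //.
  exact: measurable_int (Radon_Nikodym_SigmaFinite.f_integrable dom).
- apply: emeasurable_funM => //; apply/measurable_EFinP.
  exact: measurable_normal_pdf.
- apply: ae_eqe_mul2l; apply: integral_ae_eq => //.
  + exact: Radon_Nikodym_SigmaFinite.f_integrable.
  + by apply/measurable_EFinP; exact: measurable_normal_pdf.
  + by move=> E _ mE; rewrite -Radon_Nikodym_SigmaFinite.f_integral.
Qed.

(** Since exp y >= 1 + y, x^2 exp(-x^2/4) <= 4. So x^2 times the standard density is at most a
    multiple of the density of variance 2, whose integral is 1. *)
Lemma normal_prob_second_moment :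
  (\int[@normal_prob R 0 1]_x (x ^+ 2)%:E < +oo)%E.
Proof.
rewrite ge0_integral_normal_prob; last 2 first.
  by apply/measurable_EFinP; exact: measurable_funX.
  by move=> x; rewrite lee_fin sqr_ge0.
pose s : R := Num.sqrt 2.
have s0 : s != 0 by rewrite gt_eqF// sqrtr_gt0.
pose c : R := 4 * normal_peak 1 / normal_peak s.
have pk0 : 0 < normal_peak s by exact: normal_peak_gt0.
have pk1 : 0 <= normal_peak (1 : R) by exact: normal_peak_ge0.
apply: (@le_lt_trans _ _ (\int[leb]_x (c%:E * (normal_pdf 0 s x)%:E))%E); last first.
  rewrite ge0_integralZl//.
  - by rewrite integral_normal_pdf mule1 ltry.
  - by apply/measurable_EFinP; exact: measurable_normal_pdf.
  - by move=> x _; rewrite lee_fin normal_pdf_ge0.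
  - by rewrite lee_fin /c !mulr_ge0// invr_ge0 ltW.
apply: ge0_le_integral => //.
- by move=> x _; rewrite -EFinM lee_fin mulr_ge0 ?sqr_ge0 ?normal_pdf_ge0.
- apply/measurable_EFinP; apply: measurable_funM; first exact: measurable_funX.
  exact: measurable_normal_pdf.
- apply/measurable_EFinP; apply: measurable_funM => //.
  exact: measurable_normal_pdf.
move=> x _; rewrite -!EFinM lee_fin !normal_pdfE ?oner_eq0//.
have -> : c * (normal_peak s * normal_fun 0 s x) =
    normal_peak 1 * (4 * normal_fun 0 s x).
  by rewrite /c; field; rewrite gt_eqF.
rewrite mulrCA ler_wpM2l// /normal_fun subr0 expr1n sqr_sqrtr//.
have -> : - x ^+ 2 / (1 *+ 2) = - x ^+ 2 / (2 *+ 2) + - x ^+ 2 / (2 *+ 2).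
  by field.
rewrite expRD mulrA ler_wpM2r ?expR_ge0//.
rewrite mulNr expRN ler_pdivrMr ?expR_gt0//.
have := @expR_ge1Dx R (x ^+ 2 / (2 *+ 2)).
have := sqr_ge0 x; lra.
Qed.

End NormalLaw.

(** * Projections and affine images of Gaussian vectors *)

Section GaussianVectors.
Context {R : realType} {k : nat}.

Lemma sqr_colE p (u : 'cV[R]_p) : (u^T *m u) 0 0 = \sum_i u i 0 ^+ 2.
Proof. by rewrite mxE; apply: eq_bigr => i _; rewrite mxE expr2. Qed.

Definition measurable_coords d (Om : measurableType d) (Z : Om -> 'cV[R]_k) :=
  forall i, measurable_fun setT (fun w => Z w i 0).

Lemma measurable_mulmx d (Om : measurableType d) p (A : 'M[R]_(p, k))
    (Z : Om -> 'cV[R]_k) (i : 'I_p) :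
  measurable_coords Z -> measurable_fun setT (fun w => (A *m Z w) i 0).
Proof.
move=> mZ; under eq_fun do rewrite mxE.
by apply: measurable_sum => j; apply: measurable_funM => //; exact: measurable_cst.
Qed.

(** The hypothesis of the Cramér-Wold theorem, for vectors on two possibly different probability
    spaces. *)
Definition same_projections d1 (O1 : measurableType d1) (P1 : probability O1 R)
    d2 (O2 : measurableType d2) (P2 : probability O2 R)
    (Z1 : O1 -> 'cV[R]_k) (Z2 : O2 -> 'cV[R]_k) :=
  forall (a : 'cV[R]_k) (B : set R), measurable B ->
    P1 [set w | B ((a^T *m Z1 w) 0 0)] = P2 [set w | B ((a^T *m Z2 w) 0 0)].

Lemma gaussian_same_projections d1 (O1 : measurableType d1) (P1 : probability O1 R)
    d2 (O2 : measurableType d2) (P2 : probability O2 R) Z1 Z2 mu (K : 'M[R]_k) :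
  gaussian_vector P1 Z1 mu K -> gaussian_vector P2 Z2 mu K ->
  same_projections P1 P2 Z1 Z2.
Proof. by move=> [_ _ _ H1] [_ _ _ H2] a B mB; rewrite H1// H2. Qed.

Lemma ge0_same_projections d1 (O1 : measurableType d1) (P1 : probability O1 R)
    d2 (O2 : measurableType d2) (P2 : probability O2 R)
    (Z1 : O1 -> 'cV[R]_k) (Z2 : O2 -> 'cV[R]_k) (phi : R -> \bar R) (a : 'cV[R]_k) :
  measurable_coords Z1 -> measurable_coords Z2 -> same_projections P1 P2 Z1 Z2 ->
  measurable_fun setT phi -> (forall x, (0 <= phi x)%E) ->
  (\int[P1]_w phi ((a^T *m Z1 w) 0 0)%R = \int[P2]_w phi ((a^T *m Z2 w) 0 0)%R)%E.
Proof.
move=> mZ1 mZ2 E mphi phi0.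
have m1 := measurable_mulmx a^T 0 mZ1; have m2 := measurable_mulmx a^T 0 mZ2.
rewrite -[LHS](@ge0_integral_pushforward _ _ _ _ _ _ m1 P1 setT phi)//.
rewrite -[RHS](@ge0_integral_pushforward _ _ _ _ _ _ m2 P2 setT phi)//.
apply: eq_measure_integral => // B mB _; exact: E.
Qed.

(** Projecting mu + L Z on a is projecting Z on L^T a and shifting by a^T mu; the variance is the
    squared norm of L^T a. A degenerate projection is covered because [normal_law_shift] includes
    the Dirac case. *)
Lemma gaussian_vector_affine d (Om : measurableType d) (P : probability Om R)
    (Z : Om -> 'cV[R]_k) p (mu : 'cV[R]_p) (L : 'M[R]_(p, k)) :
  gaussian_vector P Z 0 1%:M ->
  gaussian_vector P (fun w => mu + L *m Z w) mu (L *m L^T).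
Proof.
move=> [_ _ mZ lawZ].
have quad (a : 'cV_p) : (a^T *m (L *m L^T) *m a) 0 0 =
    ((L^T *m a)^T *m (L^T *m a)) 0 0.
  by rewrite trmx_mul trmxK !mulmxA.
split.
- by rewrite trmx_mul trmxK.
- by move=> a; rewrite quad sqr_colE sumr_ge0// => i _; rewrite sqr_ge0.
- move=> i; under eq_fun do rewrite mxE.
  by apply: measurable_funD; [exact: measurable_cst|exact: measurable_mulmx].
- move=> a B mB.
  have v0 : 0 <= (a^T *m (L *m L^T) *m a) 0 0.
    by rewrite quad sqr_colE sumr_ge0// => i _; rewrite sqr_ge0.
  rewrite normal_law_shift//.
  have mB' : measurable ((fun x : R => x + (a^T *m mu) 0 0) @^-1` B).
    by rewrite -[X in measurable X]setTI; exact: (@measurable_shift R).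
  have := lawZ (L^T *m a) _ mB'.
  rewrite mulmx0 mulmx1 [X in normal_law X]mxE -quad => <-.
  congr (P _); apply: eq_set => w /=; congr (B _).
  by rewrite mulmxDr mxE addrC trmx_mul trmxK mulmxA.
Qed.

Lemma gaussian_vector_sqr d (Om : measurableType d) (P : probability Om R)
    (Z : Om -> 'cV[R]_k) i :
  gaussian_vector P Z 0 1%:M ->
  (\int[P]_w (Z w i 0 ^+ 2)%:E = \int[normal_prob 0 1]_x (x ^+ 2)%:E)%E.
Proof.
move=> [_ _ mZ lawZ].
pose a : 'cV[R]_k := delta_mx i 0.
have aZ w : (a^T *m Z w) 0 0 = Z w i 0 by rewrite trmx_delta -rowE mxE.
have m1 := measurable_mulmx a^T 0 mZ.
under eq_integral do rewrite -aZ.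
rewrite -[LHS](@ge0_integral_pushforward _ _ _ (measurableTypeR R) _ _ m1 P setT
  (fun x => (x ^+ 2)%:E))//; last 2 first.
  by apply/measurable_EFinP; exact: measurable_funX.
  by move=> x _; rewrite lee_fin sqr_ge0.
apply: eq_measure_integral => // B mB _.
apply: (etrans (lawZ a B mB)).
rewrite mulmx0 mulmx1 sqr_colE [X in normal_law X]mxE (bigD1 i)//= big1 => [|j ji].
  by rewrite mxE !eqxx/= expr1n addr0 /normal_law oner_eq0 sqrtr1.
by rewrite mxE (negbTE ji) expr0n.
Qed.

End GaussianVectors.

(** * Trigonometric approximation *)

Section TrigApprox.
Context {R : realType} {k : nat}.
Implicit Types (h : 'cV[R]_k -> R) (s : seq (R * 'cV[R]_k * R)).

(** A term is (amplitude, frequency, phase). With phases, cosines alone also represent sines and are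
    closed under products. *)
Definition trig_poly s (z : 'cV[R]_k) : R :=
  \sum_(q <- s) q.1.1 * cos ((q.1.2^T *m z) 0 0 + q.2).

(** Uniform on the whole space and not only on compact sets, so that it passes to expectations
    without tail estimates; the price is that [h] must be bounded. *)
Definition trig_approx h := forall e, 0 < e ->
  exists s, forall z, `|h z - trig_poly s z| <= e.

Lemma trig_poly_bounded s : exists2 B, 0 <= B & forall z, `|trig_poly s z| <= B.
Proof.
exists (\sum_(q <- s) `|q.1.1|) => [|z]; first exact: sumr_ge0.
apply: le_trans (ler_norm_sum _ _ _) _; apply: ler_sum => q _.
by rewrite normrM ler_piMr// cos_max.
Qed.

Lemma trig_approx_bounded h : trig_approx h ->
  exists2 B, 0 <= B & forall z, `|h z| <= B.
Proof.
move=> /(_ 1 ltr01)[s hs]; have [B B0 sB] := trig_poly_bounded s.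
exists (B + 1) => [|z]; first by rewrite addr_ge0.
rewrite -(subrK (trig_poly s z) (h z)) (le_trans (ler_normD _ _))// addrC.
by rewrite lerD.
Qed.

Lemma trig_approx_lim h :
  (forall e, 0 < e -> exists2 h', trig_approx h' & forall z, `|h z - h' z| <= e) ->
  trig_approx h.
Proof.
move=> H e e0; have e20 : 0 < e / 2 by rewrite divr_gt0.
have [h' /(_ _ e20)[s hs] hh'] := H _ e20.
exists s => z; rewrite -(subrK (h' z) (h z)) -addrA (le_trans (ler_normD _ _))//.
by rewrite (splitr e) lerD.
Qed.

Lemma trig_approx_cst c : trig_approx (fun=> c).
Proof.
move=> e e0; exists [:: (c, 0, 0)] => z.
by rewrite /trig_poly big_seq1/= trmx0 mul0mx mxE addr0 cos0 mulr1 subrr normr0 ltW.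
Qed.

Lemma trig_approx_sin c (a : 'cV[R]_k) :
  trig_approx (fun z => c * sin ((a^T *m z) 0 0)).
Proof.
move=> e e0; exists [:: (c, a, - (pi / 2))] => z.
rewrite /trig_poly big_seq1/= cosD cosN sinN cos_pihalf sin_pihalf.
by rewrite mulr0 add0r mulrN1 opprK subrr normr0 ltW.
Qed.

Lemma trig_approxD h h' :
  trig_approx h -> trig_approx h' -> trig_approx (fun z => h z + h' z).
Proof.
move=> H H' e e0; have e20 : 0 < e / 2 by rewrite divr_gt0.
have [[s hs] [s' hs']] := (H _ e20, H' _ e20).
exists (s ++ s') => z; rewrite /trig_poly big_cat/= opprD addrACA.
by rewrite (le_trans (ler_normD _ _))// (splitr e) lerD.
Qed.

(** Each pair of terms is expanded by cos u cos v = (cos(u + v) + cos(u - v)) / 2. *)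
Lemma trig_polyM s s' : exists s'', forall z,
  trig_poly s'' z = trig_poly s z * trig_poly s' z.
Proof.
pose f (q q' : R * 'cV[R]_k * R) : seq (R * 'cV[R]_k * R) :=
  [:: (q.1.1 * q'.1.1 / 2, q.1.2 + q'.1.2, q.2 + q'.2);
      (q.1.1 * q'.1.1 / 2, q.1.2 - q'.1.2, q.2 - q'.2)].
exists (flatten [seq f q q' | q <- s, q' <- s']) => z.
rewrite /trig_poly big_flatten/= big_allpairs_dep/= mulr_suml.
apply: eq_bigr => q _; rewrite mulr_sumr; apply: eq_bigr => q' _.
rewrite /f big_cons big_seq1/= !linearD/= linearN/= !mulmxDl mulNmx.
rewrite [in X in cos X]mxE [X in _ + _ * cos (X + _)]mxE.
rewrite [in X in _ + _ * cos (_ + X + _)]mxE.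
set x := (_^T *m z) 0 0; set y := (_^T *m z) 0 0.
have -> : x + y + (q.2 + q'.2) = (x + q.2) + (y + q'.2) by ring.
have -> : x - y + (q.2 - q'.2) = (x + q.2) - (y + q'.2) by ring.
by rewrite cosB cosD; field.
Qed.

Lemma trig_approxM h h' :
  trig_approx h -> trig_approx h' -> trig_approx (fun z => h z * h' z).
Proof.
move=> H H'; apply: trig_approx_lim => e e0.
have aux C : 0 <= C -> C * (e / 2 / (C + 1)) <= e / 2.
  by move=> C0; rewrite mulrA ler_pdivrMr ?ltr_wpDl//; nra.
have [B B0 hB] := trig_approx_bounded H.
(* The accuracies are chosen in turn: [B'] bounds the approximant of h', and only then fixes how
   well h is approximated. *)
have e1 : 0 < e / 2 / (B + 1) by rewrite !divr_gt0// ltr_wpDl.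
have [s' hs'] := H' _ e1.
have [B' B'0 sB'] := trig_poly_bounded s'.
have e2 : 0 < e / 2 / (B' + 1) by rewrite !divr_gt0// ltr_wpDl.
have [s hs] := H _ e2.
have [s'' s''E] := trig_polyM s s'.
exists (trig_poly s''); first by move=> ? ?; exists s'' => z; rewrite subrr normr0 ltW.
move=> z; rewrite s''E.
have -> : h z * h' z - trig_poly s z * trig_poly s' z =
  h z * (h' z - trig_poly s' z) + (h z - trig_poly s z) * trig_poly s' z by ring.
rewrite (le_trans (ler_normD _ _))// !normrM (splitr e) lerD//.
  by apply: le_trans (ler_pM _ _ (hB z) (hs' z)) _ => //; exact: aux.
by rewrite mulrC; apply: le_trans (ler_pM _ _ (sB' z) (hs z)) _ => //; exact: aux.
Qed.

Lemma trig_approxZ c h : trig_approx h -> trig_approx (fun z => c * h z).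
Proof. exact: (trig_approxM (trig_approx_cst c)). Qed.

(* The classical iteration p <- p + (x - p^2) / 2 of the Stone-Weierstrass
   theorem, which increases to sqrt x on [0, 1]. *)
Fixpoint sqrt_iter (n : nat) (x : R) : R :=
  if n is n'.+1 then sqrt_iter n' x + (x - sqrt_iter n' x ^+ 2) / 2 else 0.

(** The error obeys r - p' = (r - p)(1 - (r + p)/2) with r = sqrt x. The resulting rate 2/n does not
    depend on x, in spite of the infinite slope of the root at 0. *)
Lemma sqrt_iterP n (x : R) : 0 <= x <= 1 ->
  [/\ 0 <= sqrt_iter n x, sqrt_iter n x <= Num.sqrt x &
      n%:R * (Num.sqrt x - sqrt_iter n x) <= 2].
Proof.
move=> /andP[x0 x1]; set r := Num.sqrt x.
have r0 : 0 <= r by exact: sqrtr_ge0.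
have r1 : r <= 1 by rewrite -sqrtr1 ler_wsqrtr.
have rr : x = r ^+ 2 by rewrite sqr_sqrtr.
(* A stronger bound carries the induction. It propagates because (2 + (n+1) r)(1 - r/2) <= 2 + n r,
   and dividing it by r > 0 gives the rate. *)
suff : [/\ 0 <= sqrt_iter n x, sqrt_iter n x <= r &
      (2 + n%:R * r) * (r - sqrt_iter n x) <= 2 * r].
  move=> [p0 pr H]; split => //.
  have n0 : 0 <= n%:R :> R by [].
  move: (n%:R) (sqrt_iter n x) n0 p0 pr H => N p N0 p0 pr H.
  have [r00|rn0] := eqVneq r 0; first by nra.
  have {}r0 : 0 < r by rewrite lt_def rn0.
  have := ler_pM2r r0 (N * (r - p)) 2 => <-; nra.
elim: n => [|n [p0 pr H]] /=; first by split=> //; lra.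
move: (sqrt_iter n x) p0 pr H => p p0 pr H; rewrite rr.
have h4 : 0 <= r - p by lra.
have h5 : 0 <= (r - p) * (r + p) by rewrite mulr_ge0//; lra.
have h6 : 0 <= (r - p) * (2 - (r + p)) by rewrite mulr_ge0//; lra.
split; [nra|nra|].
have n0 : 0 <= n%:R :> R by [].
have -> : n.+1%:R = n%:R + 1 :> R by rewrite natr1.
move: (n%:R) n0 H => N n0 H.
have -> : r - (p + (r ^+ 2 - p ^+ 2) / 2) = (r - p) * (1 - (r + p) / 2) by field.
have h1 : (2 + (N + 1) * r) * (1 - (r + p) / 2) <= 2 + N * r.
  have h2 : 1 - (r + p) / 2 <= 1 - r / 2 by lra.
  have h3 : 0 <= (2 + (N + 1) * r) by nra.
  have := ler_wpM2l h3 h2; nra.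
by rewrite [X in _ * X]mulrC mulrA; exact: le_trans (ler_wpM2r h4 h1) H.
Qed.

(** After rescaling into [0, 1], the iterates are polynomials in the function, hence approximable,
    and they converge to its root uniformly. *)
Lemma trig_approx_sqrt h : (forall z, 0 <= h z) ->
  trig_approx h -> trig_approx (fun z => Num.sqrt (h z)).
Proof.
move=> h0 H; have [B B0 hB] := trig_approx_bounded H.
have B1 : 0 < B + 1 by rewrite ltr_wpDl.
pose u z := (B + 1)^-1 * h z.
have u01 z : 0 <= u z <= 1.
  apply/andP; split; first by rewrite mulr_ge0// invr_ge0 ltW.
  rewrite /u mulrC ler_pdivrMr// mul1r.
  by rewrite (le_trans (ler_norm _))// (le_trans (hB _))// lerDl.
suff U : trig_approx (fun z => Num.sqrt (u z)).
  rewrite (_ : (fun z => _) = fun z => Num.sqrt (B + 1) * Num.sqrt (u z)).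
    exact: trig_approxZ.
  by apply/funext => z; rewrite -sqrtrM ?ltW// /u mulrA divff ?mul1r ?gt_eqF.
have it n : trig_approx (fun z => sqrt_iter n (u z)).
  elim: n => [|n IH] /=; first exact: trig_approx_cst.
  apply: trig_approxD => //.
  rewrite (_ : (fun z => _) = fun z =>
    2^-1 * (u z + -1 * (sqrt_iter n (u z) * sqrt_iter n (u z)))); last first.
    by apply/funext => z; rewrite expr2; field.
  apply/trig_approxZ/trig_approxD; first exact: trig_approxZ.
  by apply: trig_approxZ; exact: trig_approxM.
apply: trig_approx_lim => e e0.
pose n := (Num.truncn (2 / e)).+1.
exists (fun z => sqrt_iter n (u z)) => // z.
have [_ pr H2] := sqrt_iterP n (u01 z).
rewrite ger0_norm ?subr_ge0//.
have n2 : 2 / e < n%:R by exact: truncnS_gt.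
rewrite -(@ler_pM2l _ n%:R) ?ltr0n// (le_trans H2)//.
by rewrite -ler_pdivrMr// ltW.
Qed.

End TrigApprox.

(** * Uniqueness of laws from projections *)

Section ProbabilityIntegrals.
Context {R : realType} d (T : measurableType d) (P : probability T R).
Implicit Types f g : T -> R.

Lemma bounded_integrable f B : measurable_fun setT f ->
  (forall w, `|f w| <= B) -> P.-integrable setT (EFin \o f).
Proof.
move=> mf fB; apply: measurable_bounded_integrable => //.
  by rewrite -ge0_fin_numE// fin_num_measure.
exists B; split; first exact: num_real.
by move=> M BM w _ /=; exact: le_trans (fB w) (ltW BM).
Qed.

Lemma probability_Rintegral_cst c : \int[P]_w c = c.
Proof.
by rewrite Rintegral_cst//= probability_setT mulr1.
Qed.

Lemma Rintegral_dist f g e :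
  P.-integrable setT (EFin \o f) -> P.-integrable setT (EFin \o g) ->
  (forall w, `|f w - g w| <= e) -> `|\int[P]_w f w - \int[P]_w g w| <= e.
Proof.
move=> If Ig fg; rewrite -RintegralB//.
have Ifg : P.-integrable setT (EFin \o (fun w => f w - g w)).
  by rewrite (_ : _ \o _ = (EFin \o f) \- (EFin \o g))%E//; exact: integrableB.
apply: le_trans (le_normr_Rintegral measurableT Ifg) _.
rewrite -[leRHS]probability_Rintegral_cst; apply: le_Rintegral => //.
- by rewrite (_ : _ \o _ = abse \o (EFin \o (fun w => f w - g w)))//;
    exact: integrable_abse.
- by apply: (@bounded_integrable _ `|e|) => //; exact: measurable_cst.
Qed.

End ProbabilityIntegrals.

Section SinBounds.
Context {R : realType}.
Implicit Types x : R.

Lemma abs_sin_le x : `|sin x| <= `|x|.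
Proof.
suff H (y : R) : 0 <= y -> `|sin y| <= y.
  have [x0|x0] := leP 0 x; first by rewrite (ger0_norm x0) H.
  by rewrite (ltr0_norm x0) -normrN -sinN H// oppr_ge0 ltW.
move=> y0; have [c _] : exists2 c, c \in `[0, y] & sin y - sin 0 = cos c * (y - 0).
  apply: (@MVT_segment _ sin cos) => //.
  by apply: continuous_subspaceT; exact: continuous_sin.
rewrite sin0 !subr0 => ->; rewrite normrM (ger0_norm y0) ler_piMl//.
exact: cos_max.
Qed.

Lemma abs_cos_sub1_le x : 0 <= x -> `|cos x - 1| <= x.
Proof.
move=> x0; have [c _] : exists2 c, c \in `[0, x] &
    cos x - cos 0 = - sin c * (x - 0).
  apply: (@MVT_segment _ cos (fun z => - sin z)) => //.
  by apply: continuous_subspaceT; exact: continuous_cos.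
rewrite cos0 !subr0 => ->; rewrite normrM (ger0_norm x0) ler_piMl//.
by rewrite normrN sin_max.
Qed.

(** A quadratic error suffices for N sin(x / N) to tend to x, the total error being at most x^2 /
    N. *)
Lemma abs_sin_sub_le x : `|sin x - x| <= x ^+ 2.
Proof.
suff H (y : R) : 0 <= y -> `|sin y - y| <= y ^+ 2.
  have [x0|x0] := leP 0 x; first exact: H.
  rewrite -sqrrN -normrN opprD -sinN; apply: H.
  by rewrite oppr_ge0 ltW.
move=> y0; have [c cy] : exists2 c, c \in `[0, y] & sin y - sin 0 = cos c * (y - 0).
  apply: (@MVT_segment _ sin cos) => //.
  by apply: continuous_subspaceT; exact: continuous_sin.
rewrite sin0 !subr0 => ->; rewrite -[X in _ - X]mul1r -mulrBl normrM (ger0_norm y0).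
move: cy; rewrite in_itv/= => /andP[c0 cy].
by rewrite expr2 ler_wpM2r// (le_trans (abs_cos_sub1_le c0)).
Qed.

End SinBounds.

Section SqrtAlgebra.
Context {R : realType} {k : nat}.

(** Being inductive, the class gets continuity, measurability, approximability after truncation and
    convergence of the truncations each by one induction. Radicands are nonnegative everywhere, as
    the polynomial iteration for the root requires. *)
Inductive sqrt_alg : ('cV[R]_k -> R) -> Prop :=
| sqrt_alg_cst c : sqrt_alg (fun=> c)
| sqrt_alg_coord i : sqrt_alg (fun z => z i 0)
| sqrt_algD g h : sqrt_alg g -> sqrt_alg h -> sqrt_alg (fun z => g z + h z)
| sqrt_algM g h : sqrt_alg g -> sqrt_alg h -> sqrt_alg (fun z => g z * h z)
| sqrt_alg_sqrt g : (forall z, 0 <= g z) -> sqrt_alg g ->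
    sqrt_alg (fun z => Num.sqrt (g z)).

Lemma sqrt_alg_continuous g : sqrt_alg g -> continuous g.
Proof.
elim=> {g} [c|i|g h _ cg _ ch|g h _ cg _ ch|g _ _ cg]; move=> z.
- exact: cst_continuous.
- exact: coord_continuous.
- exact: (cvgD (cg z) (ch z)).
- exact: (cvgM (cg z) (ch z)).
- by apply: continuous_comp; [exact: cg|exact: sqrt_continuous].
Qed.

Lemma measurable_sqrt_alg g d (Om : measurableType d) (Z : Om -> 'cV[R]_k) :
  sqrt_alg g -> measurable_coords Z -> measurable_fun setT (fun w => g (Z w)).
Proof.
move=> + mZ; elim=> {g} [c|i|g h _ mg _ mh|g h _ mg _ mh|g _ _ mg].
- exact: measurable_cst.
- exact: mZ.
- exact: measurable_funD.
- exact: measurable_funM.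
- apply: measurableT_comp mg.
  by apply: continuous_measurable_fun; exact: sqrt_continuous.
Qed.

(** The coordinatewise map z -> M sin(z / M) with M = n + 1. It makes coordinates bounded and
    trigonometric while never increasing their absolute value, so one integrable majorant serves all
    n. *)
Definition sin_trunc (n : nat) (z : 'cV[R]_k) : 'cV[R]_k :=
  \col_i (n.+1%:R * sin (n.+1%:R^-1 * z i 0)).

Lemma sin_trunc_le n z i : `|sin_trunc n z i 0| <= `|z i 0|.
Proof.
rewrite mxE normrM ger0_norm// (le_trans (ler_wpM2l _ (abs_sin_le _)))//.
by rewrite normrM ger0_norm ?invr_ge0// mulrA divff// mul1r.
Qed.

Lemma sin_trunc_cvg z i : sin_trunc n z i 0 @[n --> \oo] --> z i 0.
Proof.
apply/cvgrPdist_le => e e0.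
near=> n; rewrite distrC mxE.
set N : R := n.+1%:R; set x := z i 0.
have N0 : 0 < N by rewrite ltr0n.
have -> : N * sin (N^-1 * x) - x = N * (sin (N^-1 * x) - N^-1 * x).
  by rewrite mulrBr mulrA divff ?mul1r// gt_eqF.
rewrite normrM gtr0_norm// (le_trans (ler_wpM2l (ltW N0) (abs_sin_sub_le _)))//.
have -> : N * (N^-1 * x) ^+ 2 = x ^+ 2 / N by field; rewrite gt_eqF.
rewrite ler_pdivrMr// -ler_pdivrMl//.
apply: ltW; apply: lt_trans (_ : n%:R < _); last by rewrite ltr_nat.
near: n; exact: nbhs_infty_gtr.
Unshelve. all: by end_near. Qed.

Lemma measurable_sin_trunc n d (Om : measurableType d) (Z : Om -> 'cV[R]_k) :
  measurable_coords Z -> measurable_coords (fun w => sin_trunc n (Z w)).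
Proof.
move=> mZ i; under eq_fun do rewrite mxE.
apply: measurable_funM; first exact: measurable_cst.
apply: measurableT_comp (_ : measurable_fun setT (fun w => n.+1%:R^-1 * Z w i 0)).
  by apply: continuous_measurable_fun; exact: continuous_sin.
by apply: measurable_funM; [exact: measurable_cst|exact: mZ].
Qed.

Lemma trig_approx_sin_trunc g n : sqrt_alg g ->
  trig_approx (fun z => g (sin_trunc n z)).
Proof.
elim=> {g} [c|i|g h _ mg _ mh|g h _ mg _ mh|g g0 _ mg].
- exact: trig_approx_cst.
- rewrite (_ : (fun z => _) = fun z : 'cV[R]_k =>
    n.+1%:R * sin (((n.+1%:R^-1 *: delta_mx i (0 : 'I_1))^T *m z) 0 0)).
    exact: trig_approx_sin.
  apply/funext => z; rewrite mxE linearZ/= trmx_delta -scalemxAl -rowE.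
  by rewrite !mxE.
- exact: trig_approxD.
- exact: trig_approxM.
- exact: trig_approx_sqrt.
Qed.

Lemma sqrt_alg_sin_trunc_cvg g z : sqrt_alg g ->
  g (sin_trunc n z) @[n --> \oo] --> g z.
Proof.
elim=> {g} [c|i|g h _ mg _ mh|g h _ mg _ mh|g g0 _ mg].
- exact: cvg_cst.
- exact: sin_trunc_cvg.
- exact: cvgD.
- exact: cvgM.
- by apply: (cvg_comp _ Num.sqrt mg); exact: sqrt_continuous.
Qed.

Section SameLaw.
Context d1 (O1 : measurableType d1) (P1 : probability O1 R)
    d2 (O2 : measurableType d2) (P2 : probability O2 R)
    (Z1 : O1 -> 'cV[R]_k) (Z2 : O2 -> 'cV[R]_k).
Hypotheses (mZ1 : measurable_coords Z1) (mZ2 : measurable_coords Z2)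
  (same : same_projections P1 P2 Z1 Z2).

Lemma measurable_cosD (b : R) : measurable_fun setT (fun x : R => cos (x + b)).
Proof.
apply: measurableT_comp (_ : measurable_fun setT (fun x : R => (x + b)%R)).
  by apply: continuous_measurable_fun; exact: continuous_cos.
by apply: measurable_funD => //; exact: measurable_cst.
Qed.

Lemma integrable_cos_proj d (Om : measurableType d) (P : probability Om R) Z
    (a : 'cV[R]_k) b : measurable_coords Z ->
  P.-integrable setT (EFin \o (fun w => cos ((a^T *m Z w) 0 0 + b))).
Proof.
move=> mZ; apply: (@bounded_integrable _ _ _ _ _ 1) => [|w]; last exact: cos_max.
exact: measurableT_comp (measurable_cosD b) (measurable_mulmx a^T 0 mZ).
Qed.

Lemma cos_proj_same (a : 'cV[R]_k) b :
  \int[P1]_w cos ((a^T *m Z1 w) 0 0 + b) = \int[P2]_w cos ((a^T *m Z2 w) 0 0 + b).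
Proof.
(* 1 + cos is nonnegative, so transfer of nonnegative integrals along projections applies. *)
apply: (addrI (1 : R)).
have E d (Om : measurableType d) (P : probability Om R) Z : measurable_coords Z ->
    1 + \int[P]_w cos ((a^T *m Z w) 0 0 + b) =
    \int[P]_w (1 + cos ((a^T *m Z w) 0 0 + b)).
  move=> mZ; rewrite RintegralD//; last exact: integrable_cos_proj.
    by rewrite probability_Rintegral_cst.
  apply: (@bounded_integrable _ _ _ _ _ 1) => [|_]; first exact: measurable_cst.
  by rewrite normr1.
rewrite !E//; congr fine.
apply: (@ge0_same_projections _ _ _ _ _ _ _ _ Z1 Z2 (fun x : R => (1 + cos (x + b))%:E)) => //.
apply/measurable_EFinP; apply: measurable_funD; first exact: measurable_cst.
exact: measurable_cosD.
Qed.

Lemma integrable_trig_poly d (Om : measurableType d) (P : probability Om R) Z s :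
  measurable_coords Z ->
  P.-integrable setT (EFin \o (fun w => trig_poly s (Z w : 'cV[R]_k))).
Proof.
move=> mZ; have [B _ sB] := trig_poly_bounded s.
apply: (@bounded_integrable _ _ _ _ _ B) => [|w]; last exact: sB.
apply: measurable_sum => q; apply: measurable_funM; first exact: measurable_cst.
exact: measurableT_comp (measurable_cosD q.2) (measurable_mulmx q.1.2^T 0 mZ).
Qed.

Lemma trig_poly_same s :
  \int[P1]_w trig_poly s (Z1 w) = \int[P2]_w trig_poly s (Z2 w).
Proof.
elim: s => [|q s IH].
  by under eq_Rintegral do rewrite /trig_poly big_nil;
     under [RHS]eq_Rintegral do rewrite /trig_poly big_nil;
     rewrite !probability_Rintegral_cst.
have E d (Om : measurableType d) (P : probability Om R) Z : measurable_coords Z ->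
  \int[P]_w trig_poly (q :: s) (Z w) =
  q.1.1 * (\int[P]_w cos ((q.1.2^T *m Z w) 0 0 + q.2)) + \int[P]_w trig_poly s (Z w).
  move=> mZ; under eq_Rintegral do rewrite /trig_poly big_cons -/(trig_poly s _).
  rewrite -RintegralZl//; last exact: integrable_cos_proj.
  rewrite RintegralD//; last exact: integrable_trig_poly.
  rewrite (_ : _ \o _ = fun w => (q.1.1%:E * (cos ((q.1.2^T *m Z w) 0 0 + q.2))%:E)%E)//.
  by apply: integrableZl => //; exact: integrable_cos_proj.
by rewrite !E// IH cos_proj_same.
Qed.

Lemma trig_approx_same h : trig_approx h ->
  measurable_fun setT (fun w => h (Z1 w)) -> measurable_fun setT (fun w => h (Z2 w)) ->
  \int[P1]_w h (Z1 w) = \int[P2]_w h (Z2 w).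
Proof.
move=> H m1 m2; have [B _ hB] := trig_approx_bounded H.
apply/eqP; rewrite -subr_eq0; apply/negP => /negP ne.
have e0 : 0 < `|\int[P1]_w h (Z1 w) - \int[P2]_w h (Z2 w)| by rewrite normr_gt0.
set D := `|_| in e0.
(* Two integrals at distance D > 0 would, through a common trigonometric polynomial within D/4, be
   at distance at most D/2. *)
have e40 : 0 < D / 4 by rewrite divr_gt0.
have [s hs] := H _ e40.
have I1 := bounded_integrable P1 m1 (fun w => hB (Z1 w)).
have I2 := bounded_integrable P2 m2 (fun w => hB (Z2 w)).
have D1 := Rintegral_dist I1 (integrable_trig_poly P1 s mZ1) (fun w => hs (Z1 w)).
have D2 := Rintegral_dist I2 (integrable_trig_poly P2 s mZ2) (fun w => hs (Z2 w)).
rewrite trig_poly_same in D1.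
have : D <= D / 4 + D / 4.
  rewrite /D -{1}(subrK (\int[P2]_w trig_poly s (Z2 w)) (\int[P1]_w h (Z1 w))).
  rewrite -addrA (le_trans (ler_normD _ _))// lerD// distrC.
  exact: D2.
lra.
Qed.

(** The truncated functions have equal expectations on both sides. Linear growth and integrable
    coordinates dominate them, so both expectations of g are the limit of the same sequence. *)
Lemma sqrt_alg_same g C c : sqrt_alg g ->
  (forall z, `|g z| <= C + c * \sum_i `|z i 0|) -> 0 <= c ->
  (forall i, P1.-integrable setT (EFin \o (fun w => Z1 w i 0))) ->
  (forall i, P2.-integrable setT (EFin \o (fun w => Z2 w i 0))) ->
  \int[P1]_w g (Z1 w) = \int[P2]_w g (Z2 w).
Proof.
move=> Ag gC c0 iZ1 iZ2.
have cvgE d (Om : measurableType d) (P : probability Om R) Z : measurable_coords Z ->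
    (forall i, P.-integrable setT (EFin \o (fun w => Z w i 0))) ->
    (\int[P]_w (g (sin_trunc n (Z w)))%:E)%E @[n --> \oo] --> (\int[P]_w (g (Z w))%:E)%E
    /\ P.-integrable setT (EFin \o (fun w => g (Z w))).
  move=> mZ iZ.
  have mT n := measurable_sin_trunc n mZ.
  have [|||||i1 _ c1] := @dominated_convergence _ _ _ P setT measurableT
    (fun n w => (g (sin_trunc n (Z w)))%:E) (fun w => (g (Z w))%:E)
    (fun w => (C%:E + c%:E * \sum_i `|(Z w i 0)%:E|)%E).
  - by move=> n; apply/measurable_EFinP; exact: measurable_sqrt_alg.
  - by apply/measurable_EFinP; exact: measurable_sqrt_alg.
  - apply: aeW => w _; apply: cvg_EFin; first exact: nearW.
    exact: sqrt_alg_sin_trunc_cvg.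
  - apply: integrableD => //.
      by apply: (@bounded_integrable _ _ _ _ (fun=> C) `|C|) => //; exact: measurable_cst.
    apply: integrableZl => //; apply: integrable_sum => //= i _.
    exact: (integrable_abse (iZ i)).
  - apply: aeW => w n _; rewrite sumEFin -EFinM -EFinD lee_fin.
    apply: le_trans (gC _) _; rewrite lerD2l ler_wpM2l// ler_sum// => i _.
    exact: sin_trunc_le.
  by split.
have [c1 i1] := cvgE _ _ P1 Z1 mZ1 iZ1.
have [c2 i2] := cvgE _ _ P2 Z2 mZ2 iZ2.
congr fine; apply: (cvg_unique _ c1); first exact: ereal_hausdorff.
apply: cvg_trans c2; apply: near_eq_cvg; apply: nearW => n.
have H := trig_approx_sin_trunc n Ag; have [B _ hB] := trig_approx_bounded H.
have m1 := measurable_sqrt_alg Ag (measurable_sin_trunc n mZ1).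
have m2 := measurable_sqrt_alg Ag (measurable_sin_trunc n mZ2).
have I1 := bounded_integrable P1 m1 (fun w => hB (Z1 w)).
have I2 := bounded_integrable P2 m2 (fun w => hB (Z2 w)).
rewrite -[LHS]fineK; last exact: (integrable_fin_num measurableT I2).
rewrite -[RHS]fineK; last exact: (integrable_fin_num measurableT I1).
by congr EFin; apply/esym; exact: trig_approx_same H m1 m2.
Qed.

End SameLaw.
End SqrtAlgebra.

(** * A strong law of large numbers *)

Section SumOfSquares.
Context {R : realType} d (T : measurableType d) (P : probability T R).
Variables (X : nat -> T -> R) (v : R).
Hypotheses (iXX : forall s t, P.-integrable setT (EFin \o (fun w => X s w * X t w)))
  (X2 : forall t, \int[P]_w (X t w * X t w) <= v)
  (X0 : forall s t, s != t -> \int[P]_w (X s w * X t w) = 0).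

Lemma Rintegral_sum_integrable (f : nat -> T -> R) n :
  (forall t, P.-integrable setT (EFin \o f t)) ->
  P.-integrable setT (EFin \o (fun w => \sum_(t < n) f t w)) /\
  \int[P]_w (\sum_(t < n) f t w) = \sum_(t < n) \int[P]_w f t w.
Proof.
move=> iF; elim: n => [|n [IH1 IH2]].
  split.
    rewrite (_ : _ \o _ = cst 0%E); last by apply/funext => w; rewrite /= big_ord0.
    exact: integrable0.
  rewrite big_ord0; under eq_Rintegral do rewrite big_ord0.
  by rewrite Rintegral_cst// mul0r.
have E : (fun w => \sum_(t < n.+1) f t w) = (fun w => \sum_(t < n) f t w + f n w).
  by apply/funext => w; rewrite big_ord_recr.
split.
  rewrite E (_ : _ \o _ = (EFin \o (fun w => (\sum_(t < n) f t w)%R)) \+ (EFin \o f n))%E//.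
  exact: integrableD.
by rewrite E RintegralD// IH2 big_ord_recr.
Qed.

(** Off-diagonal terms of the expanded square vanish, so the second moment grows only linearly. *)
Lemma sum_sqr_le n :
  P.-integrable setT (EFin \o (fun w => (\sum_(t < n) X t w) ^+ 2)) /\
  \int[P]_w ((\sum_(t < n) X t w) ^+ 2) <= n%:R * v.
Proof.
have E w : (\sum_(t < n) X t w) ^+ 2 = \sum_(s < n) \sum_(t < n) X s w * X t w.
  by rewrite expr2 mulr_suml; apply: eq_bigr => s _; rewrite mulr_sumr.
have H1 s := Rintegral_sum_integrable n (iXX s).
have H2 := Rintegral_sum_integrable n (fun s => (H1 s).1).
split; first by under eq_fun do rewrite E; exact: H2.1.
under eq_Rintegral do rewrite E.
rewrite H2.2 (_ : n%:R * v = \sum_(s < n) v); last first.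
  by rewrite sumr_const card_ord mulr_natl.
apply: ler_sum => s _; rewrite (H1 s).2 (bigD1 s)//= big1 ?addr0// => t ts.
by rewrite X0// eq_sym.
Qed.

End SumOfSquares.

Section Interpolation.
Context {R : realType}.
Implicit Types y : nat -> R.

Lemma square_bracket N : (0 < N)%N ->
  exists k, ((k.+1 ^ 2 <= N)%N /\ (N < k.+2 ^ 2)%N).
Proof.
elim: N => // N IH _; case: (posnP N) => [->|N0]; first by exists 0%N.
have [k [k1 k2]] := IH N0.
have [H|H] := ltnP N.+1 (k.+2 ^ 2); first by exists k; split=> //; rewrite leqW.
by exists k.+1; split=> //; apply: leq_ltn_trans k2 _; rewrite ltn_exp2r.
Qed.

Lemma cvg_ratio_succ : (k.+2%:R / k.+1%:R : R) @[k --> \oo] --> (1 : R).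
Proof.
rewrite -[X in _ --> X]addr0.
have -> : (fun k => k.+2%:R / k.+1%:R : R) = fun k => 1 + k.+1%:R^-1.
  by apply/funext => k; rewrite -[k.+2%:R]natr1 mulrDl divff ?pnatr_eq0// mul1r.
by apply: cvgD; [exact: cvg_cst|exact: cvg_harmonic].
Qed.

(* The partial sums are nondecreasing, hence controlled by their values at the
   squares, whose consecutive ratios tend to 1. *)
Lemma cesaro_interpolation y (c : R) : (forall t, 0 <= y t) ->
  ((k.+1 ^ 2)%:R^-1 * \sum_(t < k.+1 ^ 2) y t) @[k --> \oo] --> c ->
  (N%:R^-1 * \sum_(t < N) y t) @[N --> \oo] --> c.
Proof.
move=> y0; set a := (fun k : nat => _) => ac.
have ac1 : a k.+1 @[k --> \oo] --> c by rewrite cvg_shiftS.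
pose r k : R := k.+2%:R / k.+1%:R.
(* For (k+1)^2 <= N < (k+2)^2, enlarging the sum and shrinking the divisor gives the upper bound
   a_(k+1) r_k^2; the opposite changes give the lower bound a_k / r_k^2. *)
have r0 k : 0 < r k by rewrite divr_gt0.
have rc : r k @[k --> \oo] --> (1 : R) := cvg_ratio_succ.
have up : a k.+1 * r k ^+ 2 @[k --> \oo] --> c.
  rewrite -[c]mulr1 -(expr1n _ 2); apply: cvgM => //.
  by apply: (cvg_comp _ (fun x => x ^+ 2) rc); exact: exprn_continuous.
have lo : a k * (r k)^-1 ^+ 2 @[k --> \oo] --> c.
  rewrite -[c]mulr1 -(expr1n _ 2) -[X in _ * X ^+ 2]invr1; apply: cvgM => //.
  apply: (cvg_comp _ (fun x => x ^+ 2)); last exact: exprn_continuous.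
  by apply: cvgV => //; rewrite oner_eq0.
have mono m n : (m <= n)%N -> \sum_(t < m) y t <= \sum_(t < n) y t.
  move=> mn; rewrite -!(big_mkord xpredT y) (big_cat_nat (leq0n m) mn)//= lerDl.
  exact: sumr_ge0.
apply/cvgrPdist_le => e e0.
move/cvgrPdist_le : up => /(_ e e0)[K1 _ HK1].
move/cvgrPdist_le : lo => /(_ e e0)[K2 _ HK2].
pose K := maxn K1 K2.
exists (K.+2 ^ 2)%N => //= N /= KN.
have N0 : (0 < N)%N by apply: leq_trans KN; rewrite expn_gt0.
have [k [k1 k2]] := square_bracket N0.
have Kk : (K <= k)%N.
  have : (K.+2 ^ 2 < k.+2 ^ 2)%N by exact: leq_ltn_trans k2.
  by rewrite ltn_exp2r// !ltnS => /ltnW.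
have := HK1 k (leq_trans (leq_maxl _ _) Kk).
have := HK2 k (leq_trans (leq_maxr _ _) Kk).
rewrite /= !ler_distl => /andP[lo1 lo2] /andP[up1 up2].
have k10 : 0 < k.+1%:R :> R by rewrite ltr0n.
have k20 : 0 < k.+2%:R :> R by rewrite ltr0n.
have S0 m : 0 <= \sum_(t < m) y t by exact: sumr_ge0.
have Nup : N%:R^-1 * \sum_(t < N) y t <= a k.+1 * r k ^+ 2.
  rewrite /a /r expr_div_n -!natrX mulrA [X in _ <= X / _]mulrAC.
  rewrite mulVf ?pnatr_eq0 ?expn_eq0// mul1r mulrC ler_pM ?invr_ge0//.
    by apply: mono; exact: ltnW.
  by rewrite lef_pV2 ?posrE ?ltr0n ?expn_gt0// ler_nat.
have Nlo : a k * (r k)^-1 ^+ 2 <= N%:R^-1 * \sum_(t < N) y t.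
  rewrite /a /r invf_div expr_div_n -!natrX mulrA [X in X / _ <= _]mulrAC.
  rewrite mulVf ?pnatr_eq0 ?expn_eq0// mul1r mulrC ler_pM ?invr_ge0//.
    by rewrite lef_pV2 ?posrE ?ltr0n ?expn_gt0// ler_nat ltnW.
  exact: mono.
by apply/andP; split; lra.
Qed.

End Interpolation.

(** * Factorisation of expectations under independence *)

Section Independence.
Context {R : realType} {d} {Om : measurableType d} (P : probability Om R).

(** Independence of the vectors is stated for the sigma-algebra generated by the open sets of
    columns; continuity of g brings events on g under it. *)
Lemma borel_preimage k (g : 'cV[R]_k -> R) (A : set R) :
  continuous g -> measurable A -> borel (g @^-1` A).
Proof.
move=> cg mA.
suff : measurable_fun setT (g : g_sigma_algebraType [set U : set 'cV[R]_k | open U] -> R).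
  by move=> /(_ measurableT A mA); rewrite setTI.
apply: (measurability _ (RGenOpens.measurableE R)) => _ [_ [a [b ->] <-]].
rewrite setTI; apply: sub_sigma_algebra => /=.
by move/continuousP : cg; apply; exact: interval_open.
Qed.

Lemma independent_vectors_pair (I : eqType) k (Z : I -> Om -> 'cV[R]_k) s t A B :
  independent_vectors P Z -> s != t -> borel A -> borel B ->
  P (Z s @^-1` A `&` Z t @^-1` B) = (P (Z s @^-1` A) * P (Z t @^-1` B))%E.
Proof.
move=> indep st bA bB.
have ts : (t == s) = false by rewrite eq_sym (negbTE st).
have := indep [:: s; t] (fun i => if i == s then A else B).
rewrite !big_cons big_nil/= mule1 eqxx ts => <-.
- congr (P _); apply/seteqP; split=> w /=.
    by move=> [wA wB] i /=; rewrite !inE => /orP[]/eqP->; rewrite ?eqxx ?ts.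
  move=> H; split.
    by have := H s; rewrite /= eqxx; apply; rewrite !inE eqxx.
  by have := H t; rewrite /= ts; apply; rewrite !inE eqxx orbT.
- by rewrite inE st.
- by move=> i; case: ifP.
Qed.

(** The joint law agrees with the product of the marginals on rectangles, hence everywhere, and
    Tonelli factors the integral. *)
Lemma ge0_integralM_indep (X Y : Om -> R) :
  measurable_fun setT X -> measurable_fun setT Y ->
  (forall w, 0 <= X w) -> (forall w, 0 <= Y w) ->
  (forall A B, measurable A -> measurable B ->
    P (X @^-1` A `&` Y @^-1` B) = (P (X @^-1` A) * P (Y @^-1` B))%E) ->
  (\int[P]_w (X w * Y w)%:E = (\int[P]_w (X w)%:E) * \int[P]_w (Y w)%:E)%E.
Proof.
move=> mX mY X0 Y0 indep.
pose Xm : {RV P >-> R} := HB.pack X (isMeasurableFun.Build _ _ _ _ X mX).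
pose Ym : {RV P >-> R} := HB.pack Y (isMeasurableFun.Build _ _ _ _ Y mY).
pose XY w := (X w, Y w).
have mXY : measurable_fun setT XY by exact: measurable_fun_pair.
pose XYm : {mfun Om >-> (R * R)%type} :=
  HB.pack XY (isMeasurableFun.Build _ _ _ _ XY mXY).
(* Positive parts make the integrand nonnegative on the whole plane; on the range of (X, Y) they
   change nothing. *)
pose phi (q : R * R) : \bar R := (Num.max q.1 0 * Num.max q.2 0)%:E.
have mphi : measurable_fun setT phi.
  apply/measurable_EFinP; apply: measurable_funM; apply: measurable_maxr => //;
  by [exact: measurable_fst|exact: measurable_snd|exact: measurable_cst].
have phi0 q : (0 <= phi q)%E by rewrite lee_fin mulr_ge0// le_max lexx orbT.
have mx : measurable_fun setT (fun x : R => (Num.max x 0)%:E).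
  apply/measurable_EFinP; apply: measurable_maxr => //; exact: measurable_cst.
have mx0 (x : R) : (0 <= (Num.max x 0)%:E)%E by rewrite lee_fin le_max lexx orbT.
transitivity (\int[pushforward P XYm]_q phi q)%E.
  rewrite ge0_integral_pushforward// preimage_setT.
  by apply: eq_integral => w _ /=; rewrite /phi/= !max_l.
transitivity (\int[(distribution P Xm \x distribution P Ym)%E]_q phi q)%E.
  apply: eq_measure_integral => A mA _; apply/esym.
  by apply: (@product_measure_unique _ _ _ _ _ (distribution P Xm) (distribution P Ym)
    (pushforward P XYm)) => // B C mB mC; exact: indep.
rewrite fubini_tonelli1//.
transitivity (\int[distribution P Xm]_x
    ((Num.max x 0)%:E * \int[distribution P Ym]_y (Num.max y 0)%:E))%E.
  apply: eq_integral => x _; rewrite /fubini_F.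
  by under eq_integral do rewrite /phi/= EFinM; rewrite ge0_integralZl.
rewrite ge0_integralZr//; last exact: integral_ge0.
rewrite !ge0_integral_distribution//; congr (_ * _)%E;
  by apply: eq_integral => w _ /=; rewrite max_l.
Qed.

End Independence.

Section StrongLaw.
Context {R : realType} d (T : measurableType d) (P : probability T R).

Lemma sum_inv_sqr_le n : \sum_(0 <= k < n) ((k.+1 ^ 2)%:R^-1 : R) <= 2.
Proof.
(* Telescoping: 1/x^2 <= 2/x - 2/(x+1) for x >= 1. *)
suff : \sum_(0 <= k < n) ((k.+1 ^ 2)%:R^-1 : R) <= 2 - 2 / n.+1%:R.
  by move/le_trans; apply; rewrite gerBl divr_ge0.
elim: n => [|n IH]; first by rewrite big_geq// divr1 subrr.
rewrite big_nat_recr//=; apply: le_trans (lerD IH (lexx _)) _.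
have -> : n.+2%:R = n.+1%:R + 1 :> R by rewrite natr1.
have : 1 <= n.+1%:R :> R by rewrite ler1n.
rewrite natrX; move: (n.+1%:R) => x x1.
rewrite -subr_ge0.
have -> : 2 - 2 / (x + 1) - (2 - 2 / x + (x ^+ 2)^-1) = (x - 1) / (x ^+ 2 * (x + 1)).
  by field; apply/andP; split; rewrite gt_eqF//; lra.
rewrite divr_ge0 ?subr_ge0// mulr_ge0 ?sqr_ge0//; lra.
Qed.

(** By monotone convergence the series of the f_k has a finite integral, so it converges almost
    everywhere and its terms tend to 0. This takes the place of Chebyshev and Borel-Cantelli. *)
Lemma ae_cvg0_summable (f : nat -> T -> R) (u : nat -> R) (B : R) :
  (forall k, measurable_fun setT (f k)) -> (forall k w, 0 <= f k w) ->
  (forall k, (\int[P]_w (f k w)%:E <= (u k)%:E)%E) ->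
  (forall n, \sum_(0 <= k < n) u k <= B) ->
  {ae P, forall w, f k w @[k --> \oo] --> (0 : R)}.
Proof.
move=> mf f0 fu uB.
pose S w := (\sum_(k <oo) (f k w)%:E)%E.
have mS : measurable_fun setT S.
  apply: ge0_emeasurable_sum => [k w _ _|k _]; first by rewrite lee_fin.
  by apply/measurable_EFinP.
have S0 w : (0 <= S w)%E by apply: nneseries_ge0 => k _ _; rewrite lee_fin.
have iS : P.-integrable setT S.
  apply/integrableP; split => //.
  under eq_integral do rewrite gee0_abs//.
  rewrite integral_nneseries//; last 2 first.
    by move=> k; apply/measurable_EFinP.
    by move=> k w _; rewrite lee_fin.
  apply: (@le_lt_trans _ _ B%:E); last exact: ltry.
  apply: lime_le.
    apply: is_cvg_nneseries => k _ _; apply: integral_ge0 => w _.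
    by rewrite lee_fin.
  apply: nearW => n; apply: (@le_trans _ _ (\sum_(0 <= k < n) (u k)%:E)%E).
    exact: lee_sum.
  by rewrite sumEFin lee_fin.
have := integrable_ae measurableT iS.
apply: filterS => w /(_ I) Sfin.
have f0' k : (0 <= (f k w)%:E)%E by rewrite lee_fin.
have Slt : (\sum_(0 <= k <oo) (f k w)%:E < +oo)%E by rewrite -ge0_fin_numE// S0.
have tail := nneseries_tail_cvg Slt (fun k _ => f0' k).
have : (f k w)%:E @[k --> \oo] --> (0 : R)%:E.
  apply: (squeeze_cvge _ (cvg_cst _) tail); apply: nearW => k.
  rewrite f0'/= (nneseries_split k 1)//.
  rewrite addn1 big_nat1 leeDl//; by apply: nneseries_ge0 => j _ _; rewrite lee_fin.
by move/fine_cvg.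
Qed.

Section NonnegUncorrelated.
Variables (Y : nat -> T -> R) (c v : R).
Hypotheses (mY : forall t, measurable_fun setT (Y t)) (Y0 : forall t w, 0 <= Y t w)
  (iY : forall t, P.-integrable setT (EFin \o Y t))
  (iYY : forall s t, P.-integrable setT (EFin \o (fun w => Y s w * Y t w)))
  (EY : forall t, \int[P]_w Y t w = c)
  (EYY : forall t, \int[P]_w (Y t w * Y t w) <= v)
  (EYsYt : forall s t, s != t -> \int[P]_w (Y s w * Y t w) = c * c).

Let X t w := Y t w - c.

Let XX s t : P.-integrable setT (EFin \o (fun w => X s w * X t w)) /\
  \int[P]_w (X s w * X t w) = \int[P]_w (Y s w * Y t w) - c * c.
Proof.
have E w : X s w * X t w = Y s w * Y t w + ((- c) * Y s w + ((- c) * Y t w + c * c)).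
  by rewrite /X; ring.
have Icc : P.-integrable setT (EFin \o (fun=> c * c)).
  apply: (@bounded_integrable _ _ _ _ _ `|c * c|) => //; exact: measurable_cst.
have IZ u : P.-integrable setT (EFin \o (fun w => - c * Y u w)).
  rewrite (_ : _ \o _ = fun w => ((- c)%:E * (Y u w)%:E)%E)//.
  by apply: integrableZl => //; exact: iY.
have ID (f g : T -> R) : P.-integrable setT (EFin \o f) ->
    P.-integrable setT (EFin \o g) ->
    P.-integrable setT (EFin \o (fun w => f w + g w)).
  move=> If Ig; rewrite (_ : _ \o _ = (EFin \o f) \+ (EFin \o g))%E//.
  exact: integrableD.
have I3 := ID _ _ (IZ t) Icc; have I2 := ID _ _ (IZ s) I3.
have I1 := ID _ _ (iYY s t) I2.
split; first by under eq_fun do rewrite E; exact: I1.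
under eq_Rintegral do rewrite E.
rewrite RintegralD// RintegralD//.
rewrite RintegralD// (RintegralZl _ measurableT (iY s)).
rewrite (RintegralZl _ measurableT (iY t)) !EY probability_Rintegral_cst.
ring.
Qed.

(** The averages of the centred variables over n = (k+1)^2 terms have second moment at most v/n,
    which is summable. Centring serves this bound only; the interpolation between squares uses the
    nonnegative Y. *)
Lemma strong_law_nonneg :
  {ae P, forall w, (N%:R^-1 * \sum_(t < N) Y t w) @[N --> \oo] --> c}.
Proof.
have v0 : 0 <= v.
  by apply: le_trans (EYY 0); apply: Rintegral_ge0 => w _; rewrite mulr_ge0.
have sumX n := @sum_sqr_le R d T P X v (fun s t => (XX s t).1) _ _ n.
have {sumX} sumX n : P.-integrable setT (EFin \o (fun w => (\sum_(t < n) X t w) ^+ 2)) /\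
    \int[P]_w ((\sum_(t < n) X t w) ^+ 2) <= n%:R * v.
  apply: sumX => [t|s t st].
    rewrite (XX t t).2; apply: le_trans (EYY t).
    by rewrite gerBl -expr2 sqr_ge0.
  by rewrite (XX s t).2 EYsYt// subrr.
pose n k := (k.+1 ^ 2)%N.
have n0 k : 0 < (n k)%:R :> R by rewrite ltr0n expn_gt0.
pose f k w := ((n k)%:R^-1 * \sum_(t < n k) X t w) ^+ 2.
have mX t : measurable_fun setT (X t).
  by apply: measurable_funB => //; exact: measurable_cst.
have fE k w : f k w = (n k)%:R^-1 ^+ 2 * (\sum_(t < n k) X t w) ^+ 2.
  by rewrite /f exprMn.
have := @ae_cvg0_summable f (fun k => (n k)%:R^-1 * v) (2 * v).
case.
- move=> k; apply: measurable_funX; apply: measurable_funM => //.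
  exact: measurable_sum.
- by move=> k w; exact: sqr_ge0.
- move=> k; have [I1 I2] := sumX (n k).
  under eq_integral do rewrite fE EFinM.
  rewrite integralZl//.
  rewrite -[X in (_ * X)%E]fineK; last exact: (integrable_fin_num measurableT I1).
  rewrite -EFinM lee_fin; apply: le_trans (ler_wpM2l _ I2) _.
    by rewrite sqr_ge0.
  by rewrite mulrA expr2 -[_^-1 * _^-1 * _]mulrA mulVf ?mulr1// gt_eqF.
- by move=> N; rewrite -mulr_suml ler_wpM2r// sum_inv_sqr_le.
move=> A [mA A0 subA]; exists A; split => // w /= H; apply: subA => /= fw; apply: H.
apply: (@cesaro_interpolation _ (fun t => Y t w)) => //.
have : Num.sqrt (f k w) @[k --> \oo] --> (0 : R).
  by rewrite -sqrtr0; apply: (cvg_comp _ Num.sqrt fw); exact: sqrt_continuous.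
under eq_fun do rewrite sqrtr_sqr.
move/norm_cvg0 => H0.
rewrite -[c]add0r.
have -> : (fun k => (k.+1 ^ 2)%:R^-1 * \sum_(t < k.+1 ^ 2) Y t w) =
    fun k => (n k)%:R^-1 * \sum_(t < n k) X t w + c.
  apply/funext => k; rewrite /X sumrB sumr_const card_ord mulrBr.
  by rewrite -[c *+ _]mulr_natl [X in _ - X]mulrA mulVf ?gt_eqF// mul1r subrK.
by apply: cvgD => //; exact: cvg_cst.
Qed.

End NonnegUncorrelated.
End StrongLaw.

(** * Lipschitz continuity of the improvement *)

Section EuclideanNorm.
Context {R : realType}.

Section FiniteSums.
Variable I : finType.
Implicit Types a b : I -> R.

Lemma sum_sqr_ge0 a : 0 <= \sum_i a i ^+ 2.
Proof. by apply: sumr_ge0 => i _; exact: sqr_ge0. Qed.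

(** With A and B the two norms, expand the nonnegative sum of the (B a_i - A b_i)^2 and divide by A
    B; zero norms are treated apart. *)
Lemma cauchy_schwarz a b :
  \sum_i a i * b i <= Num.sqrt (\sum_i a i ^+ 2) * Num.sqrt (\sum_i b i ^+ 2).
Proof.
set A := Num.sqrt _; set B := Num.sqrt _.
have A2 : A ^+ 2 = \sum_i a i ^+ 2 by rewrite sqr_sqrtr// sum_sqr_ge0.
have B2 : B ^+ 2 = \sum_i b i ^+ 2 by rewrite sqr_sqrtr// sum_sqr_ge0.
have A0 : 0 <= A by exact: sqrtr_ge0.
have B0 : 0 <= B by exact: sqrtr_ge0.
have zero (c d : I -> R) : \sum_i c i ^+ 2 = 0 -> \sum_i c i * d i = 0 :> R.
  move=> c0; apply: big1 => i _.
  suff -> : c i = 0 by rewrite mul0r.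
  apply/eqP; rewrite -sqrf_eq0 eq_le sqr_ge0 andbT -[leRHS]c0 (bigD1 i)//= lerDl.
  by apply: sumr_ge0 => j _; exact: sqr_ge0.
have [A00|An0] := eqVneq A 0.
  by rewrite A00 mul0r zero// -A2 A00 expr0n.
have [B00|Bn0] := eqVneq B 0.
  rewrite B00 mulr0; under eq_bigr do rewrite mulrC.
  by rewrite zero// -B2 B00 expr0n.
have {An0}A0 : 0 < A by rewrite lt_def An0.
have {Bn0}B0 : 0 < B by rewrite lt_def Bn0.
have : 0 <= \sum_i (B * a i - A * b i) ^+ 2 by exact: sum_sqr_ge0.
have -> : \sum_i (B * a i - A * b i) ^+ 2 =
    B ^+ 2 * (\sum_i a i ^+ 2) + A ^+ 2 * (\sum_i b i ^+ 2)
      - 2 * A * B * \sum_i a i * b i.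
  rewrite !mulr_sumr -big_split/= -sumrB; apply: eq_bigr => i _; ring.
rewrite -A2 -B2 => H.
rewrite -(ler_pM2l (mulr_gt0 A0 B0)); nra.
Qed.

Lemma l2_triangle a b : Num.sqrt (\sum_i (a i + b i) ^+ 2) <=
  Num.sqrt (\sum_i a i ^+ 2) + Num.sqrt (\sum_i b i ^+ 2).
Proof.
rewrite -(@ler_pXn2r _ 2)// ?nnegrE ?addr_ge0 ?sqrtr_ge0//.
rewrite sqr_sqrtr ?sum_sqr_ge0// sqrrD !sqr_sqrtr ?sum_sqr_ge0//.
under eq_bigr do rewrite sqrrD.
rewrite 2!big_split/= lerD2r lerD2l sumrMnl lerMn2r/=.
exact: cauchy_schwarz.
Qed.

Lemma l2_le_l1 a : Num.sqrt (\sum_i a i ^+ 2) <= \sum_i `|a i|.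
Proof.
have S0 : 0 <= \sum_i `|a i| by exact: sumr_ge0.
rewrite -(ger0_norm S0) -sqrtr_sqr ler_wsqrtr// expr2 mulr_suml.
apply: ler_sum => i _; rewrite -real_normK ?num_real// expr2 ler_wpM2l//.
by rewrite (bigD1 i)//= lerDl sumr_ge0.
Qed.

Lemma sqr_l1_le a : (\sum_i `|a i|) ^+ 2 <= #|I|%:R * \sum_i a i ^+ 2.
Proof.
have H := cauchy_schwarz (fun=> 1) (fun i => `|a i|).
have E1 : \sum_i 1 * `|a i| = \sum_i `|a i| by apply: eq_bigr => i _; rewrite mul1r.
have E2 : \sum_(i : I) (1 : R) ^+ 2 = #|I|%:R.
  by rewrite -sumr_const; apply: eq_bigr => i _; rewrite expr1n.
have E3 : \sum_i `|a i| ^+ 2 = \sum_i a i ^+ 2.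
  by apply: eq_bigr => i _; rewrite real_normK ?num_real.
rewrite E1 E2 E3 in H; have S0 : 0 <= \sum_i `|a i| by exact: sumr_ge0.
rewrite -(@sqr_sqrtr _ #|I|%:R)// -[\sum_i a i ^+ 2]sqr_sqrtr ?sum_sqr_ge0//.
by rewrite -exprMn ler_pXn2r// ?nnegrE// mulr_ge0 ?sqrtr_ge0.
Qed.

End FiniteSums.

Lemma enorm_pairE p q (A : 'M[R]_(p, q)) :
  enorm A = Num.sqrt (\sum_(ij : 'I_p * 'I_q) A ij.1 ij.2 ^+ 2).
Proof. by rewrite /enorm pair_big. Qed.

Lemma enorm_ge0 p q (A : 'M[R]_(p, q)) : 0 <= enorm A.
Proof. exact: sqrtr_ge0. Qed.

Lemma enormD p q (A B : 'M[R]_(p, q)) : enorm (A + B) <= enorm A + enorm B.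
Proof.
by rewrite !enorm_pairE; under eq_bigr do rewrite mxE; exact: l2_triangle.
Qed.

Lemma enormB_sym p q (A B : 'M[R]_(p, q)) : enorm (A - B) = enorm (B - A).
Proof.
congr Num.sqrt; apply: eq_bigr => i _; apply: eq_bigr => j _.
by rewrite !mxE -sqrrN opprB.
Qed.

Lemma enorm_dist p q (A B : 'M[R]_(p, q)) : `|enorm A - enorm B| <= enorm (A - B).
Proof.
have H1 := enormD (A - B) B; have H2 := enormD (B - A) A.
rewrite !subrK (enormB_sym B A) in H1 H2.
by rewrite ler_norml; apply/andP; split; lra.
Qed.

(** Lipschitz and growth bounds use this norm because its expectation is controlled by those of the
    coordinates and it belongs to [sqrt_alg]. *)
Definition l1 k (v : 'cV[R]_k) : R := \sum_i `|v i 0|.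

Lemma enorm_le_l1 k (v : 'cV[R]_k) : enorm v <= l1 v.
Proof.
rewrite /enorm; under eq_bigr do rewrite big_ord1.
exact: l2_le_l1.
Qed.

Lemma l1_ge0 k (v : 'cV[R]_k) : 0 <= l1 v. Proof. exact: sumr_ge0. Qed.

Lemma l1D k (u v : 'cV[R]_k) : l1 (u + v) <= l1 u + l1 v.
Proof. by rewrite /l1 -big_split; apply: ler_sum => i _; rewrite mxE ler_normD. Qed.

Lemma l1_dist k (u v : 'cV[R]_k) : `|l1 u - l1 v| <= 1 * l1 (u - v).
Proof.
have H1 := l1D (u - v) v; have H2 := l1D (v - u) u.
rewrite !subrK in H1 H2; rewrite mul1r.
have E : l1 (v - u) = l1 (u - v).
  by apply: eq_bigr => i _; rewrite !mxE distrC.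
by rewrite ler_norml; apply/andP; split; lra.
Qed.

Lemma entry_le_l1 k (v : 'cV[R]_k) i : `|v i 0| <= l1 v.
Proof. by rewrite /l1 (bigD1 i)//= lerDl sumr_ge0. Qed.

Lemma l1_mulmx k p (L : 'M[R]_(p, k)) (v : 'cV[R]_k) b :
  (forall i j, `|L i j| <= b) -> l1 (L *m v) <= p%:R * b * l1 v.
Proof.
move=> Lb; rewrite -mulrA mulr_natl -[p in leRHS]card_ord -sumr_const.
apply: ler_sum => i _; rewrite mxE (le_trans (ler_norm_sum _ _ _))//.
by rewrite mulr_sumr; apply: ler_sum => j _; rewrite normrM ler_wpM2r.
Qed.

Definition mx_close p q (e : R) (A B : 'M[R]_(p, q)) :=
  forall i j, `|A i j - B i j| <= e.

End EuclideanNorm.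

Section Improvement.
Context {R : realType} {m n : nat} (n_gt0 : (0 < n)%N) (z : 'cV[R]_m).
Local Notation D := (stackdim n.+1 m).

Lemma ler_dist_max0 (a b : R) : `|Num.max 0 a - Num.max 0 b| <= `|a - b|.
Proof.
have [a0|a0] := leP a 0; have [b0|b0] := leP b 0; rewrite ?subrr ?normr0//.
- have ab : a - b <= 0 by lra.
  by rewrite sub0r normrN (gtr0_norm b0) (ler0_norm ab); lra.
- have ab : 0 <= a - b by lra.
  by rewrite subr0 (gtr0_norm a0) (ger0_norm ab); lra.
Qed.

Lemma ler_dist_min (a b a' b' e : R) : `|a - a'| <= e -> `|b - b'| <= e ->
  `|Num.min a b - Num.min a' b'| <= e.
Proof.
rewrite !ler_norml => /andP[h1 h2] /andP[h3 h4].
by case: (leP a b) => ab; case: (leP a' b') => ab'; apply/andP; split; lra.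
Qed.

Lemma min_ord_dist (g h : 'I_n -> R) e : (forall i, `|g i - h i| <= e) ->
  `|min_ord n_gt0 g - min_ord n_gt0 h| <= e.
Proof.
move=> gh; rewrite /min_ord.
by apply: (big_ind2 (fun a b => `|a - b| <= e)) => // *; exact: ler_dist_min.
Qed.

Lemma improvement_ge0 (v : 'cV[R]_D) : 0 <= improvement n_gt0 z v.
Proof. by rewrite le_max lexx. Qed.

Lemma selector_l1 i (v : 'cV[R]_D) : l1 (@selector R m n i *m v) <= m%:R * l1 v.
Proof.
rewrite -[m%:R]mulr1; apply: l1_mulmx => r s; rewrite !mxE.
by case: (_ == s); rewrite ?normr1// normr0.
Qed.

Lemma selector_enorm_dist i (u v : 'cV[R]_D) :
  `|enorm (@selector R m n i *m u - z) - enorm (@selector R m n i *m v - z)|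
    <= m%:R * l1 (u - v).
Proof.
apply: le_trans (enorm_dist _ _) _.
rewrite opprB addrA subrK -mulmxBr.
exact: le_trans (enorm_le_l1 _) (selector_l1 _ _).
Qed.

(** Each distance to z changes by at most m l1(u - v), the factor m coming from a crude entrywise
    bound on the selector. A minimum keeps this constant and the difference of two such terms
    doubles it. *)
Lemma improvement_lipschitz (u v : 'cV[R]_D) :
  `|improvement n_gt0 z u - improvement n_gt0 z v| <= 2 * m%:R * l1 (u - v).
Proof.
apply: le_trans (ler_dist_max0 _ _) _.
set x := min_ord _ _; set y := enorm _; set x' := min_ord _ _; set y' := enorm _.
have -> : x - y - (x' - y') = (x - x') - (y - y') by ring.
rewrite (le_trans (ler_normB _ _))// -mulrA mulr_natl mulr2n lerD//.
  by apply: min_ord_dist => i; exact: selector_enorm_dist.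
exact: selector_enorm_dist.
Qed.

End Improvement.

Section SqrtAlgebraClosure.
Context {R : realType} {k : nat}.
Implicit Types g h : 'cV[R]_k -> R.

Lemma sqrt_algZ c g : sqrt_alg g -> sqrt_alg (fun z => c * g z).
Proof. exact: (sqrt_algM (sqrt_alg_cst c)). Qed.

Lemma sqrt_algB g h : sqrt_alg g -> sqrt_alg h -> sqrt_alg (fun z => g z - h z).
Proof.
move=> Ag Ah; rewrite (_ : (fun z => _) = fun z => g z + -1 * h z).
  exact/sqrt_algD/sqrt_algZ.
by apply/funext => z; rewrite mulN1r.
Qed.

Lemma sqrt_alg_sum (I : Type) (r : seq I) (F : I -> 'cV[R]_k -> R) :
  (forall i, sqrt_alg (F i)) -> sqrt_alg (fun z => \sum_(i <- r) F i z).
Proof.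
move=> AF; elim: r => [|i r IH].
  by under eq_fun do rewrite big_nil; exact: sqrt_alg_cst.
by under eq_fun do rewrite big_cons; exact: sqrt_algD.
Qed.

(** The absolute value is the root of a square; maximum and minimum follow as (g + h + |g - h|) / 2
    and (g + h - |g - h|) / 2, which brings the improvement into the class. *)
Lemma sqrt_alg_abs g : sqrt_alg g -> sqrt_alg (fun z => `|g z|).
Proof.
move=> Ag; under eq_fun do rewrite -sqrtr_sqr expr2.
apply: sqrt_alg_sqrt; last exact: sqrt_algM.
by move=> z; rewrite -expr2 sqr_ge0.
Qed.

Lemma sqrt_alg_max g h : sqrt_alg g -> sqrt_alg h ->
  sqrt_alg (fun z => Num.max (g z) (h z)).
Proof.
move=> Ag Ah.
rewrite (_ : (fun z => _) = fun z => 2^-1 * (g z + h z + `|g z - h z|)).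
  apply/sqrt_algZ/sqrt_algD; first exact: sqrt_algD.
  exact/sqrt_alg_abs/sqrt_algB.
by apply/funext => z; rewrite maxr_absE mulrC.
Qed.

Lemma sqrt_alg_min g h : sqrt_alg g -> sqrt_alg h ->
  sqrt_alg (fun z => Num.min (g z) (h z)).
Proof.
move=> Ag Ah.
rewrite (_ : (fun z => _) = fun z => 2^-1 * (g z + h z - `|g z - h z|)).
  apply/sqrt_algZ/sqrt_algB; first exact: sqrt_algD.
  exact/sqrt_alg_abs/sqrt_algB.
by apply/funext => z; rewrite minr_absE mulrC.
Qed.

Lemma sqrt_alg_bigmin (I : Type) (r : seq I) (i0 : I) (F : I -> 'cV[R]_k -> R) :
  (forall i, sqrt_alg (F i)) ->
  sqrt_alg (fun z => \big[Num.min/F i0 z]_(i <- r) F i z).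
Proof.
move=> AF; elim: r => [|i r IH].
  by under eq_fun do rewrite big_nil; exact: AF.
by under eq_fun do rewrite big_cons; exact: sqrt_alg_min.
Qed.

Lemma sqrt_alg_l1 : sqrt_alg (@l1 R k).
Proof. by apply: sqrt_alg_sum => i; apply: sqrt_alg_abs; exact: sqrt_alg_coord. Qed.

Lemma sqrt_alg_mulmx p (A : 'M[R]_(p, k)) i : sqrt_alg (fun z => (A *m z) i 0).
Proof.
under eq_fun do rewrite mxE.
by apply: sqrt_alg_sum => j; apply: sqrt_algZ; exact: sqrt_alg_coord.
Qed.

Lemma sqrt_alg_enorm p (A : 'M[R]_(p, k)) (b : 'cV[R]_p) :
  sqrt_alg (fun z => enorm (A *m z - b)).
Proof.
apply: sqrt_alg_sqrt.
  move=> z; apply: sumr_ge0 => i _; apply: sumr_ge0 => j _; exact: sqr_ge0.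
apply: sqrt_alg_sum => i; apply: sqrt_alg_sum => j.
have AE : sqrt_alg (fun z => (A *m z - b) i j).
  rewrite (_ : (fun z => _) = fun z => (A *m z) i 0 - b i 0).
    by apply: sqrt_algB; [exact: sqrt_alg_mulmx|exact: sqrt_alg_cst].
  by apply/funext => z; rewrite (ord1 j) [LHS]mxE [X in _ + X]mxE.
by under eq_fun do rewrite expr2; exact: sqrt_algM.
Qed.

Lemma sqrt_alg_affine p (g : 'cV[R]_p -> R) (mu : 'cV[R]_p) (L : 'M[R]_(p, k)) :
  sqrt_alg g -> sqrt_alg (fun z => g (mu + L *m z)).
Proof.
elim=> {g} [c|i|g h _ mg _ mh|g h _ mg _ mh|g g0 _ mg].
- exact: sqrt_alg_cst.
- rewrite (_ : (fun z => _) = fun z => mu i 0 + (L *m z) i 0).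
    by apply: sqrt_algD; [exact: sqrt_alg_cst|exact: sqrt_alg_mulmx].
  by apply/funext => z; rewrite [LHS]mxE.
- exact: sqrt_algD.
- exact: sqrt_algM.
- by apply: sqrt_alg_sqrt => // z; exact: g0.
Qed.

End SqrtAlgebraClosure.

Lemma sqrt_alg_improvement (R : realType) (m n : nat) (n_gt0 : (0 < n)%N)
  (z : 'cV[R]_m) : sqrt_alg (@improvement R m n n_gt0 z).
Proof.
apply: sqrt_alg_max; first exact: sqrt_alg_cst.
apply: sqrt_algB; last exact: sqrt_alg_enorm.
apply: (@sqrt_alg_bigmin _ _ _ _ (Ordinal n_gt0)
  (fun i v => enorm (selector (lift ord_max i) *m v - z))) => i.
exact: sqrt_alg_enorm.
Qed.

(** * Uniform law of large numbers *)

Section SampleAverages.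
Context {R : realType} {d} {Om : measurableType d} (P : probability Om R) {k : nat}.
Variable eps : nat -> Om -> 'cV[R]_k.
Hypotheses (eps_gauss : forall t, gaussian_vector P (eps t) 0 1%:M)
  (eps_indep : independent_vectors P eps).

Let meps t : measurable_coords (eps t).
Proof. by case: (eps_gauss t). Qed.

(** Only the finiteness of this moment matters; its value is never computed. *)
Let s2 : R := fine (\int[normal_prob 0 1]_x (x ^+ 2)%:E)%E.

Let s2E : (\int[normal_prob 0 1]_x (x ^+ 2)%:E)%E = s2%:E.
Proof.
rewrite fineK// ge0_fin_numE ?normal_prob_second_moment//.
by apply: integral_ge0 => x _; rewrite lee_fin sqr_ge0.
Qed.

Let eps_sqr_integrable t i :
  P.-integrable setT (EFin \o (fun w => eps t w i 0 ^+ 2)).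
Proof.
apply/integrableP; split.
  by apply/measurable_EFinP; apply: measurable_funX; exact: meps.
under eq_integral do rewrite /= ger0_norm ?sqr_ge0//.
by rewrite gaussian_vector_sqr// s2E ltry.
Qed.

Let eps_integrable t i : P.-integrable setT (EFin \o (fun w => eps t w i 0)).
Proof.
apply: (@le_integrable _ _ _ _ _ measurableT _
    (EFin \o (fun w => 1 + eps t w i 0 ^+ 2))).
- by apply/measurable_EFinP; exact: meps.
- move=> w _; rewrite /= lee_fin [leRHS]ger0_norm ?addr_ge0 ?sqr_ge0//.
  by rewrite ler_norml; apply/andP; split; nra.
- rewrite (_ : _ \o _ = (EFin \o (fun=> (1 : R)%R)) \+
      (EFin \o (fun w => eps t w i 0 ^+ 2)%R))%E//.
  apply: integrableD => //.
  apply: (@bounded_integrable _ _ _ _ _ 1) => [|_]; first exact: measurable_cst.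
  by rewrite normr1.
Qed.

Section OneFunction.
Variables (h : 'cV[R]_k -> R) (a b : R).
Hypotheses (Ah : sqrt_alg h) (h0 : forall z, 0 <= h z) (b0 : 0 <= b)
  (h_le : forall z, h z <= a + b * l1 z).

Let mh t : measurable_fun setT (fun w => h (eps t w)).
Proof. exact: measurable_sqrt_alg. Qed.

(** From (a + b l)^2 <= 2 a^2 + 2 b^2 l^2, where l is the l1 norm and l^2 is at most k times the sum
    of squares. Its expectation is the same for every t. *)
Let bound t w := 2 * a ^+ 2 + 2 * b ^+ 2 * k%:R * \sum_i eps t w i 0 ^+ 2.

Let sqr_h_le t w : h (eps t w) * h (eps t w) <= bound t w.
Proof.
have l0 := l1_ge0 (eps t w); have := sqr_l1_le (fun i => eps t w i 0).
rewrite card_ord -/(l1 _) /bound -mulrA; move: (\sum_i _) => S lS.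
have H1 := h_le (eps t w); have H0 := h0 (eps t w).
have H2 : h (eps t w) * h (eps t w) <= (a + b * l1 (eps t w)) ^+ 2.
  by rewrite -expr2 ler_pXn2r// nnegrE (le_trans H0).
have H3 : 2 * b ^+ 2 * l1 (eps t w) ^+ 2 <= 2 * b ^+ 2 * (k%:R * S).
  by rewrite ler_wpM2l// mulr_ge0// sqr_ge0.
apply: le_trans H2 _; have := sqr_ge0 (a - b * l1 (eps t w)); nra.
Qed.

Let bound_integral t : P.-integrable setT (EFin \o bound t) /\
  \int[P]_w bound t w = 2 * a ^+ 2 + 2 * b ^+ 2 * k%:R * (k%:R * s2).
Proof.
have Ic : P.-integrable setT (EFin \o (fun=> 2 * a ^+ 2)).
  by apply: (@bounded_integrable _ _ _ _ _ `|2 * a ^+ 2|) => //; exact: measurable_cst.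
have Isum : P.-integrable setT (EFin \o (fun w => \sum_i eps t w i 0 ^+ 2)).
  rewrite (_ : _ \o _ = (fun w => \sum_i (eps t w i 0 ^+ 2)%:E)%E).
    by apply: integrable_sum => //= i _; exact: eps_sqr_integrable.
  by apply/funext => w /=; rewrite sumEFin.
have IZ : P.-integrable setT (EFin \o (fun w => 2 * b ^+ 2 * k%:R * \sum_i eps t w i 0 ^+ 2)).
  rewrite (_ : _ \o _ =
      fun w => ((2 * b ^+ 2 * k%:R)%:E * (\sum_i eps t w i 0 ^+ 2)%:E)%E)//.
  exact: integrableZl.
split.
  rewrite (_ : EFin \o bound t = ((EFin \o (fun=> (2 * a ^+ 2)%R)) \+
    (EFin \o (fun w => (2 * b ^+ 2 * k%:R * \sum_i eps t w i 0 ^+ 2)%R)))%E)//.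
  exact: (integrableD measurableT Ic IZ).
rewrite RintegralD// probability_Rintegral_cst RintegralZl//.
congr (_ + _ * _); rewrite /Rintegral.
under eq_integral do rewrite -sumEFin.
rewrite ge0_integral_sum//; last 2 first.
  by move=> i; apply/measurable_EFinP; apply: measurable_funX; exact: meps.
  by move=> i w _; rewrite lee_fin sqr_ge0.
under eq_bigr do rewrite gaussian_vector_sqr// s2E.
by rewrite sumEFin/= sumr_const card_ord mulr_natl.
Qed.

Let hh_integrable s t :
  P.-integrable setT (EFin \o (fun w => h (eps s w) * h (eps t w))).
Proof.
apply: (@le_integrable _ _ _ _ _ measurableT _
    ((EFin \o bound s) \+ (EFin \o bound t))%E).
- by apply/measurable_EFinP; exact: measurable_funM.
- move=> w _; rewrite /= lee_fin.
  have [Hs Ht] := (sqr_h_le s w, sqr_h_le t w).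
  have [hs ht] := (h0 (eps s w), h0 (eps t w)).
  have bs : 0 <= bound s w by apply: le_trans Hs; rewrite mulr_ge0.
  have bt : 0 <= bound t w by apply: le_trans Ht; rewrite mulr_ge0.
  rewrite (ger0_norm (mulr_ge0 hs ht)) (ger0_norm (addr_ge0 bs bt)).
  have := sqr_ge0 (h (eps s w) - h (eps t w)); nra.
- exact: (integrableD measurableT (bound_integral s).1 (bound_integral t).1).
Qed.

Lemma sqrt_alg_integrable t : P.-integrable setT (EFin \o (fun w => h (eps t w))).
Proof.
apply: (@le_integrable _ _ _ _ _ measurableT _
    ((EFin \o (fun=> (1 : R)%R)) \+ (EFin \o (fun w => h (eps t w) * h (eps t w))%R))%E).
- by apply/measurable_EFinP.
- move=> w _; rewrite /= lee_fin.
  have ht := h0 (eps t w).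
  rewrite !ger0_norm ?addr_ge0 ?mulr_ge0//; nra.
- apply: integrableD => //.
  apply: (@bounded_integrable _ _ _ _ _ 1) => [|_]; first exact: measurable_cst.
  by rewrite normr1.
Qed.

(** That the samples are identically distributed is known through projections only, so uniqueness of
    laws is what makes their expectations equal. *)
Lemma sqrt_alg_expectation t : \int[P]_w h (eps t w) = \int[P]_w h (eps 0%N w).
Proof.
apply: (@sqrt_alg_same _ _ _ _ _ _ _ _ _ _ _ _ _ h a b) => // [|z].
  exact: gaussian_same_projections (eps_gauss t) (eps_gauss 0%N).
by rewrite ger0_norm.
Qed.

Lemma sample_average_cvg :
  {ae P, forall w, (N%:R^-1 * \sum_(t < N) h (eps t w)) @[N --> \oo]
    --> \int[P]_w h (eps 0%N w)}.
Proof.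
apply: (@strong_law_nonneg _ _ _ P (fun t w => h (eps t w)) _
   (2 * a ^+ 2 + 2 * b ^+ 2 * k%:R * (k%:R * s2))) => //.
- exact: sqrt_alg_integrable.
- exact: sqrt_alg_expectation.
- move=> t; rewrite -(bound_integral t).2; apply: le_Rintegral => //.
  exact: (bound_integral t).1.
- move=> s t st.
  have := @ge0_integralM_indep _ _ _ P (fun w => h (eps s w)) (fun w => h (eps t w))
    (mh s) (mh t) (fun w => h0 _) (fun w => h0 _).
  move=> /(_ _)/(congr1 fine) H.
  rewrite /Rintegral H; last first.
    move=> A B mA mB.
    have ch := sqrt_alg_continuous Ah.
    exact: (independent_vectors_pair eps_indep st
      (borel_preimage ch mA) (borel_preimage ch mB)).
  rewrite fineM ?integrable_fin_num//; try exact: sqrt_alg_integrable.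
  by rewrite -!/(Rintegral _ _ _) !sqrt_alg_expectation.
Qed.

End OneFunction.
End SampleAverages.

Section UniformLaw.
Context {R : realType} {d} {Om : measurableType d} (P : probability Om R) {k : nat}.
Variable eps : nat -> Om -> 'cV[R]_k.
Hypotheses (eps_gauss : forall t, gaussian_vector P (eps t) 0 1%:M)
  (eps_indep : independent_vectors P eps).
Variables (g : 'cV[R]_k -> R) (c : R).
Hypotheses (Ag : sqrt_alg g) (g0 : forall z, 0 <= g z) (c0 : 0 <= c)
  (g_lip : forall u v, `|g u - g v| <= c * l1 (u - v)).

Definition affine_mean (mu : 'cV[R]_k) (L : 'M[R]_k) : R :=
  \int[P]_w g (mu + L *m eps 0%N w).

Definition affine_average N w (mu : 'cV[R]_k) (L : 'M[R]_k) : R :=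
  N%:R^-1 * \sum_(t < N) g (mu + L *m eps t w).

Let affine_alg (mu : 'cV[R]_k) (L : 'M[R]_k) : sqrt_alg (fun z => g (mu + L *m z)).
Proof. exact: sqrt_alg_affine. Qed.

Let affine_growth (mu : 'cV[R]_k) (L : 'M[R]_k) : exists2 b, 0 <= b &
  forall z, g (mu + L *m z) <= (g 0 + c * l1 mu) + b * l1 z.
Proof.
pose B := \sum_i \sum_j `|L i j|.
have LB i j : `|L i j| <= B.
  rewrite /B (bigD1 i)//= (bigD1 j)//= -addrA lerDl addr_ge0//.
    exact: sumr_ge0.
  by apply: sumr_ge0 => *; exact: sumr_ge0.
have B0 : 0 <= B by do 2 apply: sumr_ge0 => ? _.
exists (c * (k%:R * B)) => [|z]; first by rewrite !mulr_ge0.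
have := g_lip (mu + L *m z) 0; rewrite subr0 => /(le_trans (ler_norm _)).
rewrite lerBlDl => /le_trans; apply.
rewrite -addrA lerD2l -mulrA -mulrDr ler_wpM2l//.
by apply: le_trans (l1D _ _) _; rewrite lerD2l; exact: l1_mulmx.
Qed.

Lemma affine_integrable (mu : 'cV[R]_k) (L : 'M[R]_k) t :
  P.-integrable setT (EFin \o (fun w => g (mu + L *m eps t w))).
Proof.
have [b b0 H] := affine_growth mu L.
exact: (sqrt_alg_integrable eps_gauss (affine_alg mu L) (fun z => g0 _) H t).
Qed.

Let l1_le (z : 'cV[R]_k) : l1 z <= 0 + 1 * l1 z.
Proof. by rewrite add0r mul1r. Qed.

Let l1_integrable t : P.-integrable setT (EFin \o (fun w => l1 (eps t w))).
Proof.
exact: (sqrt_alg_integrable eps_gauss (@sqrt_alg_l1 _ _) (@l1_ge0 _ _) l1_le t).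
Qed.

Let l := \int[P]_w l1 (eps 0%N w).

Let l_ge0 : 0 <= l.
Proof. by apply: Rintegral_ge0 => w _; exact: l1_ge0. Qed.

Let affine_dist e (mu mu' : 'cV[R]_k) (L L' : 'M[R]_k) z :
  0 <= e -> mx_close e mu mu' -> mx_close e L L' ->
  `|g (mu + L *m z) - g (mu' + L' *m z)| <= c * k%:R * e * (1 + l1 z).
Proof.
move=> e0 Hmu HL; apply: le_trans (g_lip _ _) _.
rewrite -!mulrA ler_wpM2l// opprD addrACA -mulmxBl mulrDr mulr1 mulrDr mulrA.
apply: le_trans (l1D _ _) _; apply: lerD.
  rewrite mulr_natl -[k in leRHS]card_ord -sumr_const; apply: ler_sum => i _.
  by rewrite !mxE.
by apply: l1_mulmx => i j; rewrite !mxE.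
Qed.

Lemma affine_mean_dist e mu mu' L L' : 0 <= e -> mx_close e mu mu' -> mx_close e L L' ->
  `|affine_mean mu L - affine_mean mu' L'| <= c * k%:R * e * (1 + l).
Proof.
move=> e0 Hmu HL; rewrite /affine_mean.
rewrite -(RintegralB measurableT (affine_integrable mu L 0) (affine_integrable mu' L' 0)).
set f := fun w => g (mu + L *m eps 0%N w) - g (mu' + L' *m eps 0%N w).
have If : P.-integrable setT (EFin \o f).
  rewrite (_ : _ \o _ = (EFin \o (fun w => g (mu + L *m eps 0%N w))) \-
    (EFin \o (fun w => g (mu' + L' *m eps 0%N w))))%E//.
  exact: (integrableB measurableT (affine_integrable mu L 0) (affine_integrable mu' L' 0)).
have I1 : P.-integrable setT (EFin \o (fun=> 1 : R)).
  apply: (@bounded_integrable _ _ _ _ _ 1) => [|_]; first exact: measurable_cst.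
  by rewrite normr1.
have Il : P.-integrable setT (EFin \o (fun w => 1 + l1 (eps 0%N w))).
  rewrite (_ : _ \o _ = (EFin \o (fun=> (1 : R)%R)) \+
    (EFin \o (fun w => l1 (eps 0%N w))))%E//.
  exact: (integrableD measurableT I1 (l1_integrable 0)).
have E : c * k%:R * e * (1 + l) = \int[P]_w (c * k%:R * e * (1 + l1 (eps 0%N w))).
  by rewrite RintegralZl// RintegralD// probability_Rintegral_cst.
rewrite E; apply: le_trans (le_normr_Rintegral measurableT If) _.
apply: le_Rintegral => //.
- by rewrite (_ : _ \o _ = abse \o (EFin \o f))//; exact: integrable_abse.
- rewrite (_ : _ \o _ = fun w => ((c * k%:R * e)%:E * (1 + l1 (eps 0%N w))%:E)%E)//.
  exact: integrableZl.
- by move=> w _; exact: affine_dist.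
Qed.

Let affine_average_dist N w e mu mu' L L' : (0 < N)%N -> 0 <= e ->
  mx_close e mu mu' -> mx_close e L L' ->
  `|affine_average N w mu L - affine_average N w mu' L'| <=
    c * k%:R * e * (1 + N%:R^-1 * \sum_(t < N) l1 (eps t w)).
Proof.
move=> N0 e0 Hmu HL; rewrite /affine_average -mulrBr -sumrB normrM.
rewrite ger0_norm ?invr_ge0//.
have -> : c * k%:R * e * (1 + N%:R^-1 * \sum_(t < N) l1 (eps t w)) =
    N%:R^-1 * \sum_(t < N) (c * k%:R * e * (1 + l1 (eps t w))).
  rewrite -mulr_sumr big_split/= sumr_const card_ord mulrCA; congr (_ * _).
  by rewrite mulrDr mulVf// pnatr_eq0 -lt0n.
rewrite ler_wpM2l ?invr_ge0// (le_trans (ler_norm_sum _ _ _))//.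
by apply: ler_sum => t _; exact: affine_dist.
Qed.

(** Matrices with entries in [-B, B] on a mesh of width 1/(J+1), both endpoints included. They are
    indexed by a finite type, so finitely many eventual bounds combine into one. *)
Definition grid (B J : nat) p q (A : 'M['I_(2 * B * J.+1).+1]_(p, q)) : 'M[R]_(p, q) :=
  \matrix_(i, j) ((A i j : nat)%:R / J.+1%:R - B%:R).

Arguments grid B J {p q} A.

Lemma grid_approx (B J p q : nat) (M : 'M[R]_(p, q)) :
  (forall i j, `|M i j| <= B%:R) ->
  exists A : 'M['I_(2 * B * J.+1).+1]_(p, q), mx_close J.+1%:R^-1 M (grid B J A).
Proof.
move=> MB.
have J0 : 0 < J.+1%:R :> R by rewrite ltr0n.
pose t i j := Num.truncn ((M i j + B%:R) * J.+1%:R).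
have pos i j : 0 <= (M i j + B%:R) * J.+1%:R.
  have := MB i j; rewrite ler_norml => /andP[H _].
  by rewrite mulr_ge0// -lerBlDr sub0r.
have tle i j : (t i j < (2 * B * J.+1).+1)%N.
  have tl : (t i j)%:R <= (M i j + B%:R) * J.+1%:R by rewrite truncn_le.
  rewrite ltnS -(ler_nat R) (le_trans tl)//.
  rewrite natrM ler_wpM2r// mul2n -addnn natrD lerD2r.
  exact: le_trans (ler_norm _) (MB i j).
exists (\matrix_(i, j) Ordinal (tle i j)) => i j.
rewrite !mxE/=.
have h1 : (t i j)%:R <= (M i j + B%:R) * J.+1%:R by rewrite /t truncn_le.
have h2 : (M i j + B%:R) * J.+1%:R < (t i j).+1%:R by exact: truncnS_gt.
have -> : M i j - ((t i j)%:R / J.+1%:R - B%:R) =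
    ((M i j + B%:R) * J.+1%:R - (t i j)%:R) / J.+1%:R.
  by field; rewrite gt_eqF.
rewrite normrM [`|_^-1|]gtr0_norm ?invr_gt0// ler_piMl ?invr_ge0//.
by rewrite ger0_norm ?subr_ge0// lerBlDl natr1 ltW.
Qed.

Lemma uniform_law :
  {ae P, forall w, forall (B : nat) e, 0 < e -> \forall N \near \oo,
    forall (mu : 'cV[R]_k) (L : 'M[R]_k),
    (forall i j, `|mu i j| <= B%:R) -> (forall i j, `|L i j| <= B%:R) ->
    `|affine_average N w mu L - affine_mean mu L| <= e}.
Proof.
have good1 := sample_average_cvg eps_gauss eps_indep (@sqrt_alg_l1 R k) (@l1_ge0 R k)
  ler01 l1_le.
(* The null set must serve every radius and accuracy, so all grids, countably many, are taken at
   once. *)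
have good2 : {ae P, forall w, forall (B J : nat) (A : 'cV['I_(2 * B * J.+1).+1]_k)
    (A' : 'M['I_(2 * B * J.+1).+1]_k),
    affine_average N w (grid B J A) (grid B J A') @[N --> \oo]
      --> affine_mean (grid B J A) (grid B J A')}.
  apply: ae_foralln => B; apply: ae_foralln => J.
  apply: filter_forall => A; apply: filter_forall => A'.
  have [b b0 H] := affine_growth (grid B J A) (grid B J A').
  exact: (sample_average_cvg eps_gauss eps_indep (affine_alg _ _) (fun z => g0 _) b0 H).
apply: filterS2 good1 good2 => w lw gw B e e0.
have e30 : 0 < e / 3 by rewrite divr_gt0.
(* Once the sample mean of the l1 norms is within 1 of its limit l, D / (J+1) bounds the error of
   replacing a pair by its grid point, both in the average and in the expectation. *)
pose D := c * k%:R * (1 + l + 1).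
have D0 : 0 <= D by rewrite !mulr_ge0// !addr_ge0.
pose J := Num.truncn (D / (e / 3)).
have J0 : 0 < J.+1%:R :> R by rewrite ltr0n.
have JD : D / J.+1%:R <= e / 3.
  rewrite ler_pdivrMr// mulrC -ler_pdivrMr//.
  by apply: ltW; exact: truncnS_gt.
have N1 : \forall N \near \oo, `|l - N%:R^-1 * \sum_(t < N) l1 (eps t w)| <= 1.
  by move/cvgrPdist_le : lw; apply.
have N2 : \forall N \near \oo, forall (A : 'cV['I_(2 * B * J.+1).+1]_k)
    (A' : 'M['I_(2 * B * J.+1).+1]_k),
    `|affine_mean (grid B J A) (grid B J A') -
      affine_average N w (grid B J A) (grid B J A')| <= e / 3.
  apply: filter_forall => A; apply: filter_forall => A'.
  by move/cvgrPdist_le : (gw B J A A'); apply.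
near=> N => mu L Bmu BL.
have N0 : (0 < N)%N by near: N; exact: nbhs_infty_gt.
have [A HA] := grid_approx J Bmu.
have [A' HA'] := grid_approx J BL.
have Ji : 0 <= J.+1%:R^-1 :> R by rewrite invr_ge0.
have H1 := affine_average_dist w N0 Ji HA HA'.
have H2 := affine_mean_dist Ji HA HA'.
have H3 : `|affine_mean (grid B J A) (grid B J A') -
    affine_average N w (grid B J A) (grid B J A')| <= e / 3.
  by move: (A) (A'); near: N.
have H4 : `|l - N%:R^-1 * \sum_(t < N) l1 (eps t w)| <= 1 by near: N.
have cJ : 0 <= c * k%:R * J.+1%:R^-1 by rewrite !mulr_ge0.
have H1' : `|affine_average N w mu L - affine_average N w (grid B J A) (grid B J A')| <= e / 3.
  apply: le_trans H1 (le_trans _ JD); rewrite /D [leRHS]mulrAC ler_wpM2l//.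
  by move: H4; rewrite ler_norml => /andP[H _]; lra.
have H2' : `|affine_mean mu L - affine_mean (grid B J A) (grid B J A')| <= e / 3.
  apply: le_trans H2 (le_trans _ JD); rewrite /D [leRHS]mulrAC ler_wpM2l//.
  by rewrite lerDl.
move: H1' H2' H3; rewrite !ler_norml => /andP[? ?] /andP[? ?] /andP[? ?].
by apply/andP; split; lra.
Unshelve. all: by end_near. Qed.

End UniformLaw.

(** * Expectations under a Gaussian law with a given root of the covariance *)

Section GaussianExpectation.
Context {R : realType} {k : nat}.
Context d {Om : measurableType d} (P : probability Om R) (eps : nat -> Om -> 'cV[R]_k).
Hypothesis eps_gauss : forall t, gaussian_vector P (eps t) 0 1%:M.
Context d1 {O1 : measurableType d1} (P1 : probability O1 R) (Z : O1 -> 'cV[R]_k).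
Variables (mu : 'cV[R]_k) (L : 'M[R]_k).
Hypothesis Z_gauss : gaussian_vector P1 Z mu (L *m L^T).

Let W w := mu + L *m eps 0%N w.

Let W_gauss : gaussian_vector P W mu (L *m L^T).
Proof. exact (gaussian_vector_affine mu L (eps_gauss 0%N)). Qed.

Let mZ : measurable_coords Z. Proof. by case: Z_gauss. Qed.
Let mW : measurable_coords W. Proof. by case: W_gauss. Qed.

Let W_integrable i : P.-integrable setT (EFin \o (fun w => W w i 0)).
Proof.
apply: (le_integrable measurableT _ _ (affine_integrable eps_gauss
  (@sqrt_alg_l1 R k) (@l1_ge0 R k) ler01 (@l1_dist R k) mu L 0)).
- by apply/measurable_EFinP; exact: mW.
- move=> w _; rewrite /= lee_fin [leRHS]ger0_norm ?l1_ge0//.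
  exact: entry_le_l1.
Qed.

Let Z_integrable i : P1.-integrable setT (EFin \o (fun w => Z w i 0)).
Proof.
apply/integrableP; split; first by apply/measurable_EFinP; exact: mZ.
have /integrableP[_ WW] := W_integrable i.
pose a : 'cV[R]_k := delta_mx i 0.
have aE (v : 'cV[R]_k) : (a^T *m v) 0 0 = v i 0 by rewrite trmx_delta -rowE mxE.
have same := gaussian_same_projections Z_gauss W_gauss.
(* A coordinate is the projection on a basis vector, so its absolute moment can be computed from the
   explicit vector W. *)
rewrite (_ : integral _ _ _ = \int[P]_w `|(W w i 0)%:E|)%E//.
transitivity (\int[P1]_w `|((a^T *m Z w) 0 0)%:E|)%E.
  by apply: eq_integral => w _; rewrite aE.
rewrite (@ge0_same_projections _ _ _ _ _ _ _ _ Z W (fun x : R => `|x%:E|%E) a mZ mW same)//.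
  by apply: eq_integral => w _; rewrite aE.
exact: measurableT_comp.
Qed.

Lemma gaussian_expectation (g : 'cV[R]_k -> R) (c : R) : sqrt_alg g -> 0 <= c ->
  (forall u v, `|g u - g v| <= c * l1 (u - v)) ->
  \int[P1]_w g (Z w) = affine_mean P eps g mu L.
Proof.
move=> Ag c0 g_lip.
apply: (@sqrt_alg_same _ _ _ _ _ _ _ _ Z W mZ mW _ g `|g 0| c) => // [|z].
  exact: gaussian_same_projections Z_gauss W_gauss.
rewrite -[g z](subrK (g 0)) addrC (le_trans (ler_normD _ _))// lerD2l.
by have := g_lip z 0; rewrite subr0.
Qed.

End GaussianExpectation.

(** * Maximisation *)

Section Compactness.
Context {R : realType}.

Lemma nbhs_forall2 (T : topologicalType) (p : T) (I J : finType)
  (Q : I -> J -> T -> Prop) : (forall i j, \forall q \near p, Q i j q) ->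
  \forall q \near p, forall i j, Q i j q.
Proof.
move=> HQ; apply: (@filter_forall _ _ _ (nbhs p)) => i.
by apply: (@filter_forall _ _ _ (nbhs p)) => j; exact: HQ.
Qed.

Lemma eq_continuous_at (T U : topologicalType) (f g : T -> U) (x : T) :
  f =1 g -> {for x, continuous f} -> {for x, continuous g}.
Proof. by move=> /funext ->. Qed.

Lemma continuous_at_sum (T : topologicalType) (I : Type) (r : seq I)
  (f : I -> T -> R) (x : T) : (forall i, {for x, continuous (f i)}) ->
  {for x, continuous (fun y => \sum_(i <- r) f i y)}.
Proof.
move=> cf; apply: (@cvg_big _ _ _ _ _ _ _ (nbhs x)) => // [|i _].
  exact: add_continuous.
exact: cf.
Qed.

(** Continuity is given at points of A only, so the zero set need not be closed in T. A cluster
    point in A is nevertheless a zero, since a nonzero value would persist nearby. *)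
Lemma compact_zeros (T : topologicalType) (A : set T) (phi : T -> R) :
  compact A -> (forall p, A p -> {for p, continuous phi}) ->
  compact (A `&` [set p | phi p = 0]).
Proof.
move=> cA cphi F PF FA.
have FA1 : F A by apply: filterS FA => p [].
have [p [Ap clp]] := cA F PF FA1.
exists p; split => //; split => //=.
apply/eqP/negP => /negP ne.
have e0 : 0 < `|phi p| by rewrite normr_gt0.
have N : \forall q \near p, `|phi p - phi q| < `|phi p|.
  by have /cvgrPdist_lt := cphi p Ap; apply.
have [q [[_ /= q0]]] := clp _ _ FA N.
by rewrite /= q0 subr0 ltxx.
Qed.

Lemma compact_max_continuous (T : topologicalType) (A : set T) (f : T -> R) :
  A !=set0 -> compact A -> (forall p, A p -> {for p, continuous f}) ->
  exists2 p, A p & forall q, A q -> f q <= f p.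
Proof.
move=> A0 cA cf.
have cfA : {within A, continuous f}.
  by apply: continuous_in_subspaceT => p /set_mem; exact: cf.
have [p /set_mem Ap H] := compact_EVT_max A0 cA cfA.
by exists p => // q Aq; apply: H; exact: mem_set.
Qed.

Lemma maxval_eq (T : Type) (X : set T) (g : T -> R) x :
  argmax X g x -> maxval X g = g x.
Proof.
move=> [Xx gx]; apply/eqP; rewrite eq_le; apply/andP; split.
  apply: ge_sup; first by exists (g x), x.
  by move=> _ [y Xy <-]; exact: gx.
apply: ub_le_sup; last by exists x.
by exists (g x) => _ [y Xy <-]; exact: gx.
Qed.

Lemma enorm_continuous d (y : 'rV[R]_d) : continuous (fun x : 'rV[R]_d => enorm (x - y)).
Proof.
move=> x; apply/(@cvgrPdist_le _ _ _ _ (nbhs_filter x)) => e e0.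
(* The topology is that of the sup norm, so the Euclidean norm is bounded by d coordinate
   deviations; [d.+1] also covers d = 0. *)
have d0 : 0 < e / d.+1%:R by rewrite divr_gt0.
have N : \forall x' \near x, forall i, `|x 0 i - (x' : 'rV[R]_d) 0 i| <= e / d.+1%:R.
  apply: (@filter_forall _ _ _ _ (nbhs_filter x)) => i.
  have /cvgrPdist_le := @coord_continuous R 1 d 0 i x; exact.
near=> x'.
apply: le_trans (enorm_dist _ _) _.
rewrite opprB addrA subrK enorm_pairE (le_trans (l2_le_l1 _))//.
have H : forall i, `|x 0 i - x' 0 i| <= e / d.+1%:R by near: x'.
apply: (@le_trans _ _ (\sum_(ij : 'I_1 * 'I_d) (e / d.+1%:R))).
  by apply: ler_sum => -[i j] _ /=; rewrite (ord1 i) !mxE.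
rewrite sumr_const card_prod !card_ord mul1n -[leLHS]mulr_natr [leLHS]mulrAC.
by rewrite ler_pdivrMr// ler_pM2l// ler_nat.
Unshelve. all: by end_near. Qed.

End Compactness.

(** * Stability of values and maximisers under uniform approximation *)

Section ArgmaxStability.
Context {R : realType} {d : nat}.
Variables (X : set 'rV[R]_d) (alpha : 'rV[R]_d -> R).
Hypothesis attained : forall X', X' `<=` X -> X' !=set0 -> compact X' ->
  argmax X' alpha !=set0.
Hypotheses (X0 : X !=set0) (X_compact : compact X).
Variables (alphahat : nat -> 'rV[R]_d -> R) (xhat : nat -> 'rV[R]_d).
Hypotheses (xhat_argmax : forall N, (0 < N)%N -> argmax X (alphahat N) (xhat N))
  (unif : forall e, 0 < e -> \forall N \near \oo,
    forall x, X x -> `|alphahat N x - alpha x| <= e).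

Lemma argmax_value_cvg : alphahat N (xhat N) @[N --> \oo] --> maxval X alpha.
Proof.
have [x ax] := attained (@subset_refl _ X) X0 X_compact.
rewrite (maxval_eq ax); have [Xx amax] := ax.
apply/cvgrPdist_le => e e0.
near=> N.
have N0 : (0 < N)%N by near: N; exact: nbhs_infty_gt.
have [Xh hmax] := xhat_argmax N0.
have U : forall x, X x -> `|alphahat N x - alpha x| <= e by near: N; exact: unif.
have := amax _ Xh; have := hmax _ Xx.
have := U _ Xx; have := U _ Xh; rewrite !ler_norml => /andP[? ?] /andP[? ?] ? ?.
by apply/andP; split; lra.
Unshelve. all: by end_near. Qed.

(** Attainment on every compact subset stands in for continuity of alpha: it turns strict inequality
    at each point of the compact set [far] into a uniform gap. *)
Lemma argmax_dist_cvg : edist_to (xhat N) (argmax X alpha) @[N --> \oo] --> (0 : R).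
Proof.
have [x ax] := attained (@subset_refl _ X) X0 X_compact.
have [Xx amax] := ax.
apply/cvgrPdist_le => e e0.
pose far := X `&` [set x' | forall y, argmax X alpha y -> e <= enorm (x' - y)].
have cfar : compact far.
  apply: compact_closedI => //.
  rewrite (_ : [set _ | _] = \bigcap_(y in argmax X alpha)
     ((fun x' => enorm (x' - y)) @^-1` [set r | e <= r])); last first.
    by apply/seteqP; split=> x' H y; exact: H.
  apply: closed_bigI => y _; apply: closed_comp; last exact: closed_ge.
  by move=> ? _; exact: enorm_continuous.
have notfar : \forall N \near \oo, ~ far (xhat N).
  have [far0|nfar] := pselect (far !=set0); last first.
    by apply: nearW => N H; apply: nfar; exists (xhat N).
  have [xf [[Xf Hf] fmax]] := attained (@subIsetl _ _ _) far0 cfar.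
  (* Equality would make [xf] a maximiser at distance at least e from itself. *)
  have gap : alpha xf < alpha x.
    rewrite lt_neqAle amax// andbT; apply/eqP => E.
    have : e <= enorm (xf - xf) by apply: Hf; split => // y Xy; rewrite E; exact: amax.
    rewrite subrr /enorm big1 ?sqrtr0 => [|i _]; last first.
      by rewrite big1// => j _; rewrite mxE expr0n.
    by rewrite leNgt e0.
  (* With two errors of a third of the gap, a far [xhat N] would still have a smaller approximate
     value than x. *)
  have g0 : 0 < (alpha x - alpha xf) / 3 by rewrite divr_gt0// subr_gt0.
  near=> N => Hfar.
  have N0 : (0 < N)%N by near: N; exact: nbhs_infty_gt.
  have [Xh hmax] := xhat_argmax N0.
  have U : forall x', X x' -> `|alphahat N x' - alpha x'| <= (alpha x - alpha xf) / 3.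
    by near: N; exact: unif.
  have := fmax _ Hfar; have := hmax _ Xx.
  have := U _ Xx; have := U _ Xh; rewrite !ler_norml => /andP[? ?] /andP[? ?] ? ?.
  lra.
near=> N.
have N0 : (0 < N)%N by near: N; exact: nbhs_infty_gt.
have [Xh _] := xhat_argmax N0.
have nf : ~ far (xhat N) by near: N.
have lb : lbound [set enorm (xhat N - y) | y in argmax X alpha] 0.
  by move=> _ [y _ <-]; exact: enorm_ge0.
have dist0 : 0 <= edist_to (xhat N) (argmax X alpha).
  by apply: lb_le_inf => //; exists (enorm (xhat N - x)), x.
rewrite sub0r normrN ger0_norm//.
rewrite leNgt; apply/negP => lt_e; apply: nf; split => // y ay.
rewrite (le_trans (ltW lt_e))//; apply: ge_inf; first by exists 0.
by exists y.
Unshelve. all: by end_near. Qed.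

End ArgmaxStability.

(** * Attainment of the maximum through pairs of a point and a root *)

Section MaximumThroughRoots.
Context {R : realType} {d k : nat}.
Variables (X : set 'rV[R]_d) (mu : 'rV[R]_d -> 'cV[R]_k) (K : 'rV[R]_d -> 'M[R]_k).
Hypotheses
  (mu_cont : forall x, X x -> forall i j, {for x, continuous (fun y => mu y i j)})
  (K_cont : forall x, X x -> forall i j, {for x, continuous (fun y => K y i j)}).

Lemma continuous_bounded_nat (X' : set 'rV[R]_d) (f : 'rV[R]_d -> R) :
  compact X' -> (forall x, X' x -> {for x, continuous f}) ->
  exists B : nat, forall x, X' x -> `|f x| <= B%:R.
Proof.
move=> cX cf; have [X0|nX] := pselect (X' !=set0); last first.
  by exists 0%N => x Xx; case: nX; exists x.
have cnf x : X' x -> {for x, continuous (fun y => `|f y|)}.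
  by move=> Xx; exact: (cvg_norm (cf x Xx)).
have [x Xx fx] := compact_max_continuous X0 cX cnf.
exists (Num.truncn `|f x|).+1 => y Xy.
by apply: le_trans (fx y Xy) _; apply: ltW; exact: truncnS_gt.
Qed.

(** M i i is the sum of the squares of row i of L, and |t| <= 1 + t^2. *)
Lemma root_entry_le (L : 'M[R]_k) (M : 'M[R]_k) i j : L *m L^T = M ->
  `|L i j| <= 1 + M i i.
Proof.
move=> <-; rewrite mxE (bigD1 j)//= mxE.
have S0 : 0 <= \sum_(l < k | l != j) L i l * L^T l i.
  by apply: sumr_ge0 => l _; rewrite mxE -expr2 sqr_ge0.
by rewrite ler_norml; apply/andP; split; nra.
Qed.

Lemma mean_root_bounded (X' : set 'rV[R]_d) : X' `<=` X -> compact X' ->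
  exists B : nat, forall x (L : 'M[R]_k), X' x -> L *m L^T = K x ->
    (forall i j, `|mu x i j| <= B%:R) /\ (forall i j, `|L i j| <= B%:R).
Proof.
move=> sX cX.
have [B1 HB1] : exists B : nat, forall x, X' x -> forall i j, `|mu x i j| <= B%:R.
  pose f x := \sum_i \sum_j `|mu x i j|.
  have [|B HB] := @continuous_bounded_nat X' f cX.
    move=> x Xx; apply: continuous_at_sum => i; apply: continuous_at_sum => j.
    exact: (cvg_norm (@mu_cont x (sX _ Xx) i j)).
  exists B => x Xx i j; apply: le_trans (HB x Xx); apply: le_trans (ler_norm _).
  rewrite /f (bigD1 i)//= (bigD1 j)//= -addrA lerDl addr_ge0//.
    exact: sumr_ge0.
  by apply: sumr_ge0 => *; exact: sumr_ge0.
have [B2 HB2] : exists B : nat, forall x, X' x -> forall i, `|K x i i| <= B%:R.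
  pose f x := \sum_i `|K x i i|.
  have [|B HB] := @continuous_bounded_nat X' f cX.
    move=> x Xx; apply: continuous_at_sum => i.
    exact: (cvg_norm (@K_cont x (sX _ Xx) i i)).
  exists B => x Xx i; apply: le_trans (HB x Xx); apply: le_trans (ler_norm _).
  by rewrite /f (bigD1 i)//= lerDl; exact: sumr_ge0.
exists (B1 + B2).+1 => x L Xx LK; split => i j.
  by apply: le_trans (HB1 x Xx i j) _; rewrite ler_nat -addnS leq_addr.
apply: le_trans (root_entry_le i j LK) _.
have := le_trans (ler_norm _) (HB2 x Xx i).
rewrite -natr1 natrD addrC => H; rewrite lerD2r (le_trans H)// lerDr.
exact: ler0n.
Qed.

Variables (H : 'cV[R]_k -> 'M[R]_k -> R) (C : R) (alpha : 'rV[R]_d -> R)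
  (L : 'rV[R]_d -> 'M[R]_k).
Hypotheses (C0 : 0 <= C)
  (H_lip : forall e m m' M M', 0 <= e -> mx_close e m m' -> mx_close e M M' ->
     `|H m M - H m' M'| <= C * e)
  (alphaE : forall x M, X x -> M *m M^T = K x -> alpha x = H (mu x) M)
  (L_root : forall x, X x -> L x *m (L x)^T = K x).

Lemma alpha_attained (X' : set 'rV[R]_d) : X' `<=` X -> X' !=set0 -> compact X' ->
  argmax X' alpha !=set0.
Proof.
move=> sX [x0 Xx0] cX.
have [B HB] := mean_root_bounded sX cX.
(* Roots are flattened to row vectors, for which a product of segments is compact. *)
pose box : set 'rV[R]_(k * k) :=
  [set v | forall i, `[- B%:R, B%:R]%classic (v 0 i)].
have cbox : compact box.
  by apply: (@rV_compact R _ (fun=> `[- B%:R, B%:R]%classic)) => i; exact: segment_compact.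
(* The matrix equation M M^T = K(x) becomes the vanishing of one real function. *)
pose phi (p : 'rV[R]_d * 'rV[R]_(k * k)) : R :=
  \sum_i \sum_j ((vec_mx p.2 *m (vec_mx p.2)^T) i j - K p.1 i j) ^+ 2.
have vec_cont (p : 'rV[R]_d * 'rV[R]_(k * k)) i j :
    {for p, continuous (fun q => vec_mx q.2 i j)}.
  apply: (eq_continuous_at (f := fun q : 'rV[R]_d * 'rV[R]_(k * k) =>
    q.2 0 (mxvec_index i j))) => [q|].
    by rewrite mxE.
  apply: (cvg_comp snd (fun v : 'rV[R]_(k * k) => v 0 (mxvec_index i j))).
    exact: cvg_snd.
  exact: coord_continuous.
have fst_cont (p : 'rV[R]_d * 'rV[R]_(k * k)) (f : 'rV[R]_d -> R) :
    {for p.1, continuous f} -> {for p, continuous (fun q => f q.1)}.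
  by move=> cf; apply: (cvg_comp fst f); [exact: cvg_fst|exact: cf].
pose A := (X' `*` box) `&` [set p | phi p = 0].
have cA : compact A.
  apply: compact_zeros; first exact: compact_setX.
  move=> p [Xp _]; apply: continuous_at_sum => i; apply: continuous_at_sum => j.
  apply: (cvg_comp _ (fun r : R => r ^+ 2)); last exact: exprn_continuous.
  apply: cvgB; last exact: (fst_cont p _ (@K_cont p.1 (sX _ Xp) i j)).
  apply: (eq_continuous_at (f := fun q : 'rV[R]_d * 'rV[R]_(k * k) =>
    \sum_l vec_mx q.2 i l * vec_mx q.2 j l)) => [q|].
    by rewrite [RHS]mxE; apply: eq_bigr => l _; rewrite [X in _ = _ * X]mxE.
  by apply: continuous_at_sum => l; exact: (cvgM (vec_cont p i l) (vec_cont p j l)).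
have phi0 p : phi p = 0 <-> vec_mx p.2 *m (vec_mx p.2)^T = K p.1.
  split=> [p0|E]; last first.
    by rewrite /phi big1// => i _; rewrite big1// => j _; rewrite E subrr expr0n.
  apply/matrixP => i j; apply/eqP; rewrite -subr_eq0 -sqrf_eq0 eq_le sqr_ge0 andbT.
  rewrite -[leRHS]p0 /phi (bigD1 i)//= (bigD1 j)//= -addrA lerDl addr_ge0//.
    by apply: sumr_ge0 => *; exact: sqr_ge0.
  by do 2 apply: sumr_ge0 => ? _; exact: sqr_ge0.
have inA x : X' x -> A (x, mxvec (L x)).
  move=> Xx; have LK := L_root (sX _ Xx); split; last first.
    by apply/phi0; rewrite /= mxvecK.
  split => //= i; rewrite /= in_itv/= -ler_norml.
  case/mxvec_indexP: i => i j; rewrite mxvecE.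
  exact: (HB x (L x) Xx LK).2.
pose F (p : 'rV[R]_d * 'rV[R]_(k * k)) := H (mu p.1) (vec_mx p.2).
have cF p : A p -> {for p, continuous F}.
  move=> [[Xp _] _]; apply/cvgrPdist_le => e e0.
  have d0 : 0 < e / (C + 1) by rewrite divr_gt0// ltr_wpDl.
  have N1 : \forall q \near p, forall i j, `|mu p.1 i j - mu q.1 i j| <= e / (C + 1).
    apply: nbhs_forall2 => i j.
    by have /cvgrPdist_le := fst_cont p _ (@mu_cont p.1 (sX _ Xp) i j); apply.
  have N2 : \forall q \near p, forall i j,
      `|vec_mx p.2 i j - vec_mx q.2 i j| <= e / (C + 1).
    apply: nbhs_forall2 => i j.
    by have /cvgrPdist_le := vec_cont p i j; apply.
  apply: filterS2 N1 N2 => q H1 H2.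
  apply: le_trans (H_lip (ltW d0) H1 H2) _.
  by rewrite mulrA ler_pdivrMr ?ltr_wpDl//; nra.
have A0 : A !=set0 by exists (x0, mxvec (L x0)); exact: inA.
have [[x v] [[/= Xx _] /phi0/= vK] Fmax] := compact_max_continuous A0 cA cF.
(* The optimal root [v] need not be the one chosen by L at x; [alphaE] evaluates alpha through any
   root, so the two values can be compared. *)
exists x; split => // y Xy.
rewrite (alphaE (sX _ Xy) (L_root (sX _ Xy))) (alphaE (sX _ Xx) vK).
by have := Fmax _ (inA y Xy); rewrite /F/= mxvecK.
Qed.

End MaximumThroughRoots.

(** * Continuity of the posterior mean and covariance *)

Section MatrixContinuity.
Context {R : realType} {d : nat}.
Implicit Types x : 'rV[R]_d.

Definition mx_cont_at x p q (F : 'rV[R]_d -> 'M[R]_(p, q)) :=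
  forall i j, {for x, continuous (fun y => F y i j)}.

Lemma mx_cont_cst x p q (A : 'M[R]_(p, q)) : mx_cont_at x (fun=> A).
Proof. by move=> i j; exact: cst_continuous. Qed.

Lemma mx_contD x p q (F G : 'rV[R]_d -> 'M[R]_(p, q)) :
  mx_cont_at x F -> mx_cont_at x G -> mx_cont_at x (fun y => F y + G y).
Proof.
move=> cF cG i j.
apply: (eq_continuous_at (f := fun y => F y i j + G y i j)) => [y|].
  by rewrite mxE.
exact: (cvgD (cF i j) (cG i j)).
Qed.

Lemma mx_contB x p q (F G : 'rV[R]_d -> 'M[R]_(p, q)) :
  mx_cont_at x F -> mx_cont_at x G -> mx_cont_at x (fun y => F y - G y).
Proof.
move=> cF cG; apply: mx_contD => // i j.
apply: (eq_continuous_at (f := fun y => - G y i j)) => [y|]; first by rewrite mxE.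
exact: (cvgN (cG i j)).
Qed.

Lemma mx_contM x p q r (F : 'rV[R]_d -> 'M[R]_(p, q)) (G : 'rV[R]_d -> 'M[R]_(q, r)) :
  mx_cont_at x F -> mx_cont_at x G -> mx_cont_at x (fun y => F y *m G y).
Proof.
move=> cF cG i j.
apply: (eq_continuous_at (f := fun y => \sum_l F y i l * G y l j)) => [y|].
  by rewrite mxE.
by apply: continuous_at_sum => l; exact: (cvgM (cF i l) (cG l j)).
Qed.

Lemma mx_cont_mxcol x n p q (F : 'I_n -> 'rV[R]_d -> 'M[R]_(p, q)) :
  (forall i, mx_cont_at x (F i)) -> mx_cont_at x (fun y => \mxcol_i F i y).
Proof.
move=> cF i j.
apply: (eq_continuous_at (f := fun y => F (tagnat.sig1 i) y (tagnat.sig2 i) j)) => [y|].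
  by rewrite mxE.
exact: cF.
Qed.

Lemma mx_cont_mxrow x n p q (F : 'I_n -> 'rV[R]_d -> 'M[R]_(p, q)) :
  (forall i, mx_cont_at x (F i)) -> mx_cont_at x (fun y => \mxrow_i F i y).
Proof.
move=> cF i j.
apply: (eq_continuous_at (f := fun y => F (tagnat.sig1 j) y i (tagnat.sig2 j))) => [y|].
  by rewrite mxE.
exact: cF.
Qed.

Lemma mx_cont_mxblock x m n p q (F : 'I_m -> 'I_n -> 'rV[R]_d -> 'M[R]_(p, q)) :
  (forall i j, mx_cont_at x (F i j)) ->
  mx_cont_at x (fun y => \mxblock_(i, j) F i j y).
Proof.
move=> cF i j.
apply: (eq_continuous_at (f := fun y =>
  F (tagnat.sig1 i) (tagnat.sig1 j) y (tagnat.sig2 i) (tagnat.sig2 j))) => [y|].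
  by rewrite mxE.
exact: cF.
Qed.

Lemma mx_cont_comp (V : normedModType R) x p q (F : V -> 'M[R]_(p, q))
    (h : 'rV[R]_d -> V) :
  {for x, continuous h} -> {for h x, continuous F} -> mx_cont_at x (fun y => F (h y)).
Proof.
move=> ch cF i j; apply: (cvg_comp (fun y => F (h y)) (fun M : 'M[R]_(p, q) => M i j)).
  exact: (continuous_comp ch cF).
exact: coord_continuous.
Qed.

End MatrixContinuity.

(** f is arbitrary outside A and so may fail to be continuous at points of A as a function on the
    whole space; the extension is continuous there. *)
Lemma C1_on_extension (R : realType) (V W : normedModType R) (A : set V) (f : V -> W) :
  C1_on A f -> exists2 g : V -> W, (forall x, A x -> f x = g x) &
    (forall x, A x -> {for x, continuous g}).
Proof.
move=> [U [g [_ AU fg dg _]]]; exists g => // x Ax.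
exact: (differentiable_continuous (dg x (AU x Ax))).
Qed.

Section PosteriorContinuity.
Context {R : realType} {d m n : nat}.
Variables (mean : 'rV[R]_d -> 'cV[R]_m) (k : 'rV[R]_d -> 'rV[R]_d -> 'M[R]_m).
Variables (sigma : 'rV[R]_m) (xs : 'I_n -> 'rV[R]_d) (ys : 'I_n -> 'cV[R]_m).
Variable X : set 'rV[R]_d.
Hypotheses (xs_X : forall t, X (xs t))
  (mean_cont : forall x, X x -> {for x, continuous mean})
  (k_cont : forall p, (X `*` X) p ->
     {for p, continuous (fun p : 'rV[R]_d * 'rV[R]_d => k p.1 p.2)}).

(** Covers in one notion the two kinds of arguments of the kernel: a fixed observed point and the
    moving candidate. *)
Let admissible x (a : 'rV[R]_d -> 'rV[R]_d) := X (a x) /\ {for x, continuous a}.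

Let k_comp_cont x a b : admissible x a -> admissible x b ->
  mx_cont_at x (fun y => k (a y) (b y)).
Proof.
move=> [Xa ca] [Xb cb].
apply: (@mx_cont_comp R d ('rV[R]_d * 'rV[R]_d)%type x m m (fun p => k p.1 p.2)
  (fun y => (a y, b y))).
  exact: (cvg_pair ca cb).
exact: k_cont.
Qed.

Let admissible_xs x t : admissible x (fun=> xs t).
Proof. by split; [exact: xs_X|exact: cst_continuous]. Qed.

Let post_mean_cont x a : admissible x a ->
  mx_cont_at x (fun y => post_mean mean k sigma xs ys (a y)).
Proof.
move=> Ha; apply: mx_contD; first by apply: mx_cont_comp Ha.2 _; exact/mean_cont/Ha.1.
apply: mx_contM; last exact: mx_cont_cst.
(* The pseudoinverse is discontinuous in general, but the Gram matrix does not involve the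
   candidate, so here it is a constant factor. *)
apply: mx_contM; last exact: mx_cont_cst.
by apply: mx_cont_mxrow => t; exact: k_comp_cont.
Qed.

Let post_cov_cont x a b : admissible x a -> admissible x b ->
  mx_cont_at x (fun y => post_cov k sigma xs (a y) (b y)).
Proof.
move=> Ha Hb; apply: mx_contB; first exact: k_comp_cont.
apply: mx_contM; last by apply: mx_cont_mxcol => t; exact: k_comp_cont.
apply: mx_contM; last exact: mx_cont_cst.
by apply: mx_cont_mxrow => t; exact: k_comp_cont.
Qed.

Let admissible_joint_pt x i : X x -> admissible x (fun y => joint_pt xs y i).
Proof.
move=> Xx; rewrite /joint_pt; case: unlift => [t|] /=; first exact: admissible_xs.
by split => //; exact: cvg_id.
Qed.

Lemma joint_mean_cont x : X x -> mx_cont_at x (joint_mean mean k sigma xs ys).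
Proof.
move=> Xx; apply: mx_cont_mxcol => i; apply: post_mean_cont.
exact: admissible_joint_pt.
Qed.

Lemma joint_cov_cont x : X x -> mx_cont_at x (joint_cov k sigma xs).
Proof.
move=> Xx; apply: mx_cont_mxblock => i j.
by apply: post_cov_cont; exact: admissible_joint_pt.
Qed.

End PosteriorContinuity.

(** * The posterior depends only on the prior restricted to X *)

Section PosteriorCongruence.
Context {R : realType} {d m n : nat}.
Variables (mean mean' : 'rV[R]_d -> 'cV[R]_m)
  (k k' : 'rV[R]_d -> 'rV[R]_d -> 'M[R]_m).
Variables (sigma : 'rV[R]_m) (xs : 'I_n -> 'rV[R]_d) (ys : 'I_n -> 'cV[R]_m).
Variable X : set 'rV[R]_d.
Hypotheses (xs_X : forall t, X (xs t)) (meanE : forall x, X x -> mean x = mean' x)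
  (kE : forall x y, X x -> X y -> k x y = k' x y).

Let data_gramE : data_gram k sigma xs = data_gram k' sigma xs.
Proof.
by rewrite /data_gram; congr (_ + _); apply/eq_mxblock => s t; rewrite kE.
Qed.

Let mxrowE a : X a -> \mxrow_(t < n) k a (xs t) = \mxrow_(t < n) k' a (xs t).
Proof. by move=> Xa; apply/eq_mxrow => t; rewrite kE. Qed.

Let joint_pt_X x i : X x -> X (joint_pt xs x i).
Proof. by move=> Xx; rewrite /joint_pt; case: unlift => [t|] /=. Qed.

Lemma joint_mean_congr x : X x ->
  joint_mean mean k sigma xs ys x = joint_mean mean' k' sigma xs ys x.
Proof.
move=> Xx; apply/eq_mxcol => i; have Xi := joint_pt_X i Xx.
rewrite /post_mean data_gramE meanE// mxrowE//; congr (_ + _ *m (_ - _)).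
by apply/eq_mxcol => t; rewrite meanE.
Qed.

Lemma joint_cov_congr x : X x ->
  joint_cov k sigma xs x = joint_cov k' sigma xs x.
Proof.
move=> Xx; apply/eq_mxblock => i j.
have [Xi Xj] := (joint_pt_X i Xx, joint_pt_X j Xx).
rewrite /post_cov data_gramE kE// mxrowE//; congr (_ - _ *m _).
by apply/eq_mxcol => t; rewrite kE.
Qed.

End PosteriorCongruence.

(** Nonemptiness of the argmax is part of the conclusion: it makes [maxval] a genuine maximum and
    [edist_to] a genuine distance, whereas the infimum over an empty set would be 0 by default. *)
Theorem theoremD1 (R : realType) (d m n : nat) (n_gt0 : (0 < n)%N)
  (X : set 'rV[R]_d) (X_compact : compact X)
  (* Gaussian process prior *)
  (d0 : measure_display) (Om0 : measurableType d0) (P0 : probability Om0 R)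
  (f : 'rV[R]_d -> Om0 -> 'cV[R]_m)
  (mean : 'rV[R]_d -> 'cV[R]_m) (k : 'rV[R]_d -> 'rV[R]_d -> 'M[R]_m)
  (f_gp : gaussian_process P0 X f mean k)
  (mean_C1 : C1_on X mean)
  (k_C1 : C1_on (X `*` X) (fun p : 'rV[R]_d * 'rV[R]_d => k p.1 p.2))
  (* observation noise *)
  (sigma : 'rV[R]_m) (zeta : 'I_n -> Om0 -> 'cV[R]_m)
  (zeta_gauss : forall t, gaussian_vector P0 (zeta t) 0 (noise_cov sigma))
  (zeta_indep : independent_vectors P0 zeta)
  (* the fixed data set, realised at the outcome w0, and the utopian point *)
  (w0 : Om0) (xs : 'I_n -> 'rV[R]_d) (xs_X : forall t, X (xs t))
  (ys : 'I_n -> 'cV[R]_m) (ysE : forall t, ys t = f (xs t) w0 + zeta t w0)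
  (z : 'cV[R]_m) (z_utopian : forall i x, X x -> z i 0 <= f x w0 i 0)
  (* the joint posterior *)
  (d1 : measure_display) (Om1 : measurableType d1) (P1 : probability Om1 R)
  (F : 'rV[R]_d -> Om1 -> 'cV[R]_(stackdim n.+1 m))
  (F_post : forall x, X x ->
    gaussian_vector P1 (F x) (joint_mean mean k sigma xs ys x)
      (joint_cov k sigma xs x))
  (* sample average approximation *)
  (L : 'rV[R]_d -> 'M[R]_(stackdim n.+1 m))
  (L_root : forall x, X x -> L x *m (L x)^T = joint_cov k sigma xs x)
  (d2 : measure_display) (Om : measurableType d2) (P : probability Om R)
  (eps : nat -> Om -> 'cV[R]_(stackdim n.+1 m))
  (eps_gauss : forall t, gaussian_vector P (eps t) 0 1%:M)
  (eps_indep : independent_vectors P eps)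
  (xhat : nat -> Om -> 'rV[R]_d) :
  let alpha := nespi n_gt0 z P1 F in
  let alphahat (N : nat) (w : Om) :=
    nespi_saa n_gt0 z (joint_mean mean k sigma xs ys) L (fun t => eps t w) N in
  (forall N w, (0 < N)%N -> argmax X (alphahat N w) (xhat N w)) ->
  [/\ argmax X alpha !=set0,
      {ae P, forall w,
         alphahat N w (xhat N w) @[N --> \oo] --> maxval X alpha} &
      {ae P, forall w,
         edist_to (xhat N w) (argmax X alpha) @[N --> \oo] --> (0 : R)}].
Proof.
move=> alpha alphahat xhat_argmax.
pose g := @improvement R m n n_gt0 z.
have Ag : sqrt_alg g by exact: sqrt_alg_improvement.
have g0 v : 0 <= g v by exact: improvement_ge0.
have c0 : 0 <= 2 * m%:R :> R by rewrite mulr_ge0.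
have g_lip := @improvement_lipschitz R m n n_gt0 z.
(* Mean and kernel are traded for extensions continuous at the points of X, which leave the
   posterior unchanged on X. *)
have [mean' meanE mean'_cont] := C1_on_extension mean_C1.
have [kk kkE kk_cont] := C1_on_extension k_C1.
pose k' x y := kk (x, y).
have kE x y : X x -> X y -> k x y = k' x y by move=> Xx Xy; exact: (kkE (x, y)).
have k'_cont p : (X `*` X) p -> {for p, continuous (fun p => k' p.1 p.2)}.
  move=> /kk_cont; apply: eq_continuous_at => -[a b]; exact: erefl.
pose mu := joint_mean mean' k' sigma xs ys.
pose K := joint_cov k' sigma xs.
have mu_cont x : X x -> mx_cont_at x mu.
  by move=> Xx; exact: (joint_mean_cont (sigma := sigma) (ys := ys) xs_X mean'_cont k'_cont Xx).
have K_cont x : X x -> mx_cont_at x K.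
  by move=> Xx; exact: (joint_cov_cont (sigma := sigma) xs_X k'_cont Xx).
have muE x (Xx : X x) : joint_mean mean k sigma xs ys x = mu x.
  exact: (joint_mean_congr sigma ys xs_X meanE kE Xx).
have KE x (Xx : X x) : joint_cov k sigma xs x = K x.
  exact: (joint_cov_congr sigma xs_X kE Xx).
pose H := affine_mean P eps g.
have LK x : X x -> L x *m (L x)^T = K x by move=> Xx; rewrite L_root// KE.
have alphaE x (M : 'M[R]_(stackdim n.+1 m)) : X x -> M *m M^T = K x -> alpha x = H (mu x) M.
  move=> Xx MK; rewrite /alpha /nespi unlock.
  apply: (gaussian_expectation eps_gauss _ Ag c0 g_lip).
  by rewrite MK -muE// -KE//; exact: F_post.
have attained X' : X' `<=` X -> X' !=set0 -> compact X' -> argmax X' alpha !=set0.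
  apply: (@alpha_attained _ _ _ X mu K mu_cont K_cont H
    (2 * m%:R * (stackdim n.+1 m)%:R * (1 + \int[P]_w l1 (eps 0%N w))) alpha L) => //.
    by rewrite !mulr_ge0// addr_ge0// Rintegral_ge0// => w _; exact: l1_ge0.
  move=> e a a' M M' e0 Ha HM.
  apply: le_trans (affine_mean_dist eps_gauss Ag g0 c0 g_lip e0 Ha HM) _.
  by rewrite [leRHS]mulrAC.
(* There is at least one observation, and it lies in X. *)
have X0 : X !=set0 by exists (xs (Ordinal n_gt0)).
have unif : {ae P, forall w, forall e, 0 < e -> \forall N \near \oo,
    forall x, X x -> `|alphahat N w x - alpha x| <= e}.
  (* One radius B contains all pairs (mu x, L x), whatever roots L selects, so the uniform law over
     pairs becomes uniform over X. *)
  have [B HB] := mean_root_bounded mu_cont K_cont (@subset_refl _ X) X_compact.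
  apply: filterS (uniform_law eps_gauss eps_indep Ag g0 c0 g_lip) => w Hw e e0.
  apply: filterS (Hw B e e0) => N HN x Xx.
  have [Bmu BL] := HB x (L x) Xx (LK x Xx).
  rewrite (alphaE x (L x) Xx (LK x Xx)) /alphahat /nespi_saa muE//.
  exact: HN.
split; first exact: attained.
- apply: filterS unif => w Hw.
  exact: (argmax_value_cvg attained X0 X_compact (fun N => xhat_argmax N w) Hw).
- apply: filterS unif => w Hw.
  exact: (argmax_dist_cvg attained X0 X_compact (fun N => xhat_argmax N w) Hw).
Qed.
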